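(* Let Assumptions (A1)–(A4) hold, let $\beta^*\in\mathrm{rowspan}(X)$, and run PCR with $k=r=\mathrm{rank}(X)$. Suppose that (i) $\rho\ge c\,\frac{\log^2(np)}{np}$; (ii) $\mathsf{snr}\ge C_{\mathrm{noise}}$; (iii) $\|\beta^*\|_2=\Omega(1)$ (i.e. bounded below by a positive constant); (iv) $\|\beta^*\|_1=O(\sqrt p)$. Then with probability at least $1-O(1/(np)^{10})$, $$\|\hat\beta-\beta^*\|_2^2\le C_{\mathrm{noise}}\log(np)\left(\frac{r\|\beta^*\|_2^2}{\mathsf{snr}^2}+\frac{\|\beta^*\|_1^2}{\mathsf{snr}^4}\right).$$
   Context: Standing setup. Integers $n,m,p\ge 1$. Deterministic matrices $X\in\mathbb{R}^{n\times p}$ with rows $x_1^T,\dots,x_n^T$ (in-sample covariates) and $X'\in\mathbb{R}^{m\times p}$ with rows $x_{n+1}^T,\dots,x_{n+m}^T$ (out-of-sample covariates); an unknown parameter $\beta^*\in\mathbb{R}^p$. Responses: $y_i=\langle x_i,\beta^*\rangle+\varepsilon_i$ for $i\le n$, $y=(y_1,\dots,y_n)^T$. Observed covariates: $z_i=(x_i+w_i)\circ\pi_i$ for $i\le n+m$, where $\circ$ is the entrywise product and $\pi_i\in\{0,1\}^p$ (a $0$ coordinate marks a missing entry, which is replaced by $0$). $Z\in\mathbb{R}^{n\times p}$ has rows $z_1^T,\dots,z_n^T$ and $Z'\in\mathbb{R}^{m\times p}$ has rows $z_{n+1}^T,\dots,z_{n+m}^T$. Assumptions: (A1) $\max_{ij}|X_{ij}|\le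 1$ and $\max_{ij}|X'_{ij}|\le 1$. (A2) $\mathrm{rank}(X)=r$, $\mathrm{rank}(X')=r'$. (A3) $\varepsilon_1,\dots,\varepsilon_n$ are independent, mean zero, sub-gaussian with $\|\varepsilon_i\|_{\psi_2}\le\sigma$. (A4) $w_1,\dots,w_{n+m}$ are independent mean-zero sub-gaussian random vectors with $\|w_i\|_{\psi_2}\le K$ and $\|\mathbb{E}[w_iw_i^T]\|_2\le\gamma^2$; all coordinates of all $\pi_i$ are independent Bernoulli($\rho$), $\rho\in(0,1]$. The families $(\varepsilon_i)$, $(w_i)$, $(\pi_i)$ are mutually independent. (A5) $\mathrm{rowspan}(X')\subseteq\mathrm{rowspan}(X)$. For a random vector $v$, $\|v\|_{\psi_2}=\sup_{\|u\|_2=1}\|u^Tv\|_{\psi_2}$. PCR: let $\hat\rho$ be the fraction of observed entries of $Z$ (i.e. $\frac1{np}\sum_{i\le n,j\le p}(\pi_i)_j$), $\tilde Z=Z/\hat\rho=\sum_{i=1}^{n\wedge p}\hat s_i\hat u_i\hat v_i^T$ its SVD (singular values in decreasing order), and for $k\in[n\wedge p]$, $\hat\beta=\big(\sum_{i=1}^k \hat s_i^{-1}\hat v_i\hat u_i^T\big)y$. Signal-to-noise ratio: $\mathsf{snr}=\rho s_r/(\sqrt n+\sqrt p)$, where $s_r$ is the smallest nonzero (the $r$-th) singular value of $X$. Constants: $C_{\mathrm{noise}}>0$ denotes a constant depending only on $(K,\gamma,\sigma)$, and $C,c>0$ absolute constants; their values may change between occurrences. *)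

(* Defs.v *)
From HB Require Import structures.
From mathcomp Require Import all_boot all_order all_algebra.
From mathcomp Require Import all_classical all_reals all_analysis.
Set Implicit Arguments. Unset Strict Implicit. Unset Printing Implicit Defensive.
Import Order.TTheory GRing.Theory Num.Theory.
Local Open Scope classical_set_scope.
Local Open Scope ring_scope.

Section Defs.
Context {d : measure_display} {T : measurableType d} {R : realType}.
Variable P : probability T R.

(* expectation of a real function (meaningful when it is integrable) *)
Definition expect (f : T -> R) : R := fine (\int[P]_x (f x)%:E).

(* Orlicz psi_2 norm of a real random variable:
   inf { t > 0 : E exp(X^2/t^2) <= 2 } (in the extended reals; +oo if empty) *)
Definition psi2 (X : T -> R) : \bar R :=
  ereal_inf [set (t%:E) | t in
     [set t : R | 0 < t /\ (\int[P]_x (expR (X x ^+ 2 / t ^+ 2))%:E <= 2%:E)%E]].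

Definition gen_sigma (F : set (T -> R)) : set (set T) :=
  <<s [set A | exists f B, F f /\ measurable B /\ A = f @^-1` B] >>.

Definition mutually_independent (I : finType) (G : I -> set (set T)) : Prop :=
  forall A : I -> set T, (forall i, G i (A i)) ->
    fine (P (\bigcap_i A i)) = \prod_(i : I) fine (P (A i)).
End Defs.

Definition norm2 {R : realType} {p : nat} (v : 'cV[R]_p) : R :=
  Num.sqrt (\sum_(j < p) v j 0 ^+ 2).
Definition norm1 {R : realType} {p : nat} (v : 'cV[R]_p) : R :=
  \sum_(j < p) `|v j 0|.

(* (s, U, V) is a (thin) singular value decomposition of A : n x p:
   A = sum_{i < n /\ p} s_i u_i v_i^T, u_i (columns of U) orthonormal,
   v_i (columns of V) orthonormal, s_0 >= s_1 >= ... >= 0.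
   Singular values are indexed from 0 (s_0 is the paper's s_1). *)
Definition is_svd {R : realType} {n p : nat} (A : 'M[R]_(n, p))
    (s : nat -> R) (U : 'M[R]_(n, minn n p)) (V : 'M[R]_(p, minn n p)) : Prop :=
  [/\ U^T *m U = 1%:M, V^T *m V = 1%:M,
      (forall i : nat, (i < minn n p)%N -> 0 <= s i),
      (forall i j : nat, (i <= j)%N -> (j < minn n p)%N -> s j <= s i) &
      A = U *m diag_mx (\row_(i < minn n p) s i) *m V^T].

(* PCR estimator with k components from a given SVD (s,U,V) of Z~ and
   responses y:  sum_{i < k} s_i^{-1} v_i u_i^T y  (with 0^-1 = 0). *)
Definition pcr_beta {R : realType} {n p : nat} (k : nat)
    (s : nat -> R) (U : 'M[R]_(n, minn n p)) (V : 'M[R]_(p, minn n p))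
    (y : 'cV[R]_n) : 'cV[R]_p :=
  \sum_(i < minn n p | (i < k)%N) (s i)^-1 *: (col i V *m ((col i U)^T *m y)).

(* Main.v *)
Require Import Defs.
From HB Require Import structures.
From mathcomp Require Import all_boot all_order all_algebra.
From mathcomp Require Import all_classical all_reals all_analysis measurable_realfun.
From mathcomp Require Import finmap ring lra.
Set Implicit Arguments. Unset Strict Implicit. Unset Printing Implicit Defensive.
Import Order.TTheory GRing.Theory Num.Theory.
Local Open Scope classical_set_scope.
Local Open Scope ring_scope.

(** With [Q = sqrt n + sqrt p] and [D = Z / rho_hat - X], everything follows from
    [||D|| = O(Q / rho)] and [||eps|| = O(Q)].

    Deterministic part.  Since [s_r(X) = snr Q / rho], a large [snr] makes
    [||D||] at most [s_r(X) / 2]; by Weyl's inequalities the [r]-th singular value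
    of [Z / rho_hat] is at least [s_r(X) / 2] and the next one at most [||D||].
    Writing [beta = X^T alpha] with [||alpha|| <= ||beta|| / s_r(X)] bounds the part of
    [beta] outside the top [r] right singular vectors by [O(||D|| ||alpha||)], and
    the estimator differs from the projection of [beta] by the pseudo-inverse
    applied to [eps - D beta].  Altogether the error is [O(||beta|| / snr)], which
    is the first term of the bound.

    Probabilistic part.  [Z - rho X] is the sum of the masked noise [w o pi] and
    of [X o (pi - rho)].  For fixed [v], the psi_2 bound and independence give
    [E exp(||(w o pi) v||^2 / (2K)^2) <= 2^n], and for fixed [u, v] the form
    [u^T (X o (pi - rho)) v] is sub-gaussian; a union bound over lattice nets of
    cardinality [2^(18 n)] and [2^(18 p)] gives operator norms [O(sqrt (n + p))]
    outside an event of probability [O(exp(- 10 (n + p)))].  The noise [eps] and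
    the deviation of [rho_hat] are treated in the same way. *)

(** * Operator norms and singular values *)

(** Cauchy-Schwarz: [B * (A * B - C ^+ 2)] is a sum of squares, so the claim follows on dividing by
    [B]; if [B] vanishes, so does every [b i]. *)
Lemma sum_mul_sqr_le (R : realFieldType) (I : finType) (a b : I -> R) :
  (\sum_i a i * b i) ^+ 2 <= (\sum_i a i ^+ 2) * (\sum_i b i ^+ 2).
Proof.
set A := \sum_i a i ^+ 2; set B := \sum_i b i ^+ 2; set C := \sum_i a i * b i.
have B0 : 0 <= B by apply: sumr_ge0 => i _; exact: sqr_ge0.
have H : 0 <= B * (A * B - C ^+ 2).
  have -> : B * (A * B - C ^+ 2) = \sum_i (B * a i - C * b i) ^+ 2.
    under eq_bigr => i _.
      have -> : (B * a i - C * b i) ^+ 2 =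
        B ^+ 2 * a i ^+ 2 + ((- (2 * B * C)) * (a i * b i) + C ^+ 2 * b i ^+ 2).
        by ring.
      over.
    rewrite !big_split /= -!mulr_sumr -/A -/B -/C; ring.
  by apply: sumr_ge0 => i _; exact: sqr_ge0.
have [B00|Bn0] := eqVneq B 0.
  have b0 i : b i = 0.
    have /eqP := B00; rewrite psumr_eq0; last by move=> j _; exact: sqr_ge0.
    by move=> /allP /(_ i (mem_index_enum _)); rewrite sqrf_eq0 => /eqP.
  rewrite /C big1; first by rewrite expr0n mulr_ge0 // sumr_ge0 // => i _; exact: sqr_ge0.
  by move=> i _; rewrite b0 mulr0.
by move: H; rewrite pmulr_rge0 ?subr_ge0 // lt_neqAle eq_sym Bn0.
Qed.

Section EuclideanNorm.
Variable R : realType.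
Implicit Types p q : nat.

Lemma norm2_ge0 p (v : 'cV[R]_p) : 0 <= norm2 v.
Proof. exact: sqrtr_ge0. Qed.

Lemma norm2_sqr p (v : 'cV[R]_p) : norm2 v ^+ 2 = \sum_j v j 0 ^+ 2.
Proof. by rewrite sqr_sqrtr // sumr_ge0 // => j _; exact: sqr_ge0. Qed.

Lemma norm2_le p (v : 'cV[R]_p) (c : R) :
  0 <= c -> \sum_j v j 0 ^+ 2 <= c ^+ 2 -> norm2 v <= c.
Proof. by move=> c0; rewrite -norm2_sqr ler_pXn2r // nnegrE // norm2_ge0. Qed.

Lemma norm2_0 p : norm2 (0 : 'cV[R]_p) = 0.
Proof.
by rewrite /norm2 big1 ?sqrtr0 // => j _; rewrite mxE expr0n.
Qed.

Lemma norm2_eq0 p (v : 'cV[R]_p) : (norm2 v == 0) = (v == 0).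
Proof.
apply/eqP/eqP => [v0|->]; last exact: norm2_0.
have /eqP : \sum_j v j 0 ^+ 2 = 0 by rewrite -norm2_sqr v0 expr0n.
rewrite psumr_eq0 => [/allP H|j _]; last exact: sqr_ge0.
apply/colP => j; rewrite mxE; apply/eqP.
by have := H j (mem_index_enum _); rewrite sqrf_eq0.
Qed.

Lemma norm2Z p (a : R) (v : 'cV[R]_p) : norm2 (a *: v) = `|a| * norm2 v.
Proof.
rewrite /norm2 -sqrtr_sqr -sqrtrM ?sqr_ge0 // mulr_sumr.
by congr Num.sqrt; apply: eq_bigr => j _; rewrite mxE exprMn.
Qed.

Lemma norm2N p (v : 'cV[R]_p) : norm2 (- v) = norm2 v.
Proof. by rewrite -scaleN1r norm2Z normrN1 mul1r. Qed.

Lemma dotE p (u v : 'cV[R]_p) : (u^T *m v) 0 0 = \sum_j u j 0 * v j 0.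
Proof. by rewrite mxE; apply: eq_bigr => j _; rewrite mxE. Qed.

Lemma dotvv p (v : 'cV[R]_p) : (v^T *m v) 0 0 = norm2 v ^+ 2.
Proof. by rewrite dotE norm2_sqr; apply: eq_bigr => j _; rewrite expr2. Qed.

Lemma dot_le_norm2 p (u v : 'cV[R]_p) : (u^T *m v) 0 0 <= norm2 u * norm2 v.
Proof.
apply: le_trans (ler_norm _) _.
rewrite -(@ler_pXn2r _ 2) // ?nnegrE ?mulr_ge0 ?norm2_ge0 //.
by rewrite real_normK ?num_real // exprMn !norm2_sqr dotE sum_mul_sqr_le.
Qed.

Lemma norm2D_le p (u v : 'cV[R]_p) : norm2 (u + v) <= norm2 u + norm2 v.
Proof.
apply: norm2_le; first by rewrite addr_ge0 ?norm2_ge0.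
rewrite -norm2_sqr -dotvv [(u + v)^T]linearD /= mulmxDl !mulmxDr.
have := dot_le_norm2 u v; have := dot_le_norm2 v u.
move: (dotvv u) (dotvv v); rewrite !mxE.
move=> -> ->; nra.
Qed.

Lemma norm2B_le p (u v : 'cV[R]_p) : norm2 (u - v) <= norm2 u + norm2 v.
Proof. by rewrite -[norm2 v]norm2N; exact: norm2D_le. Qed.

Lemma norm2_ortho p q (U : 'M[R]_(p, q)) (a : 'cV[R]_q) :
  U^T *m U = 1%:M -> norm2 (U *m a) = norm2 a.
Proof.
move=> UU; apply/eqP; rewrite -(@eqrXn2 _ 2) ?norm2_ge0 //.
by rewrite -!dotvv trmx_mul mulmxA -(mulmxA a^T) UU mulmx1.
Qed.

(** Bessel's inequality: pairing [y] with its projection [U *m (U^T *m y)] gives the squared norm of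
    [U^T *m y], so Cauchy-Schwarz and one division suffice. *)
Lemma norm2_ortho_tr p q (U : 'M[R]_(p, q)) (y : 'cV[R]_p) :
  U^T *m U = 1%:M -> norm2 (U^T *m y) <= norm2 y.
Proof.
move=> UU; have := dot_le_norm2 y (U *m (U^T *m y)).
rewrite norm2_ortho // mulmxA -{1}[U]trmxK -trmx_mul dotvv expr2.
have [->|n0] := eqVneq (norm2 (U^T *m y)) 0; first by rewrite norm2_ge0.
by rewrite ler_pM2r // lt_neqAle eq_sym n0 norm2_ge0.
Qed.

Lemma diag_mulE p (t : 'rV[R]_p) (a : 'cV[R]_p) i :
  (diag_mx t *m a) i 0 = t 0 i * a i 0.
Proof. by rewrite mul_diag_mx mxE. Qed.

(** Here and in the next lemma the entries of [t] are constrained only where [a] is nonzero, so that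
    vectors supported on leading or trailing coordinates are covered. *)
Lemma norm2_diag_le p (t : 'rV[R]_p) (a : 'cV[R]_p) (M : R) :
  0 <= M -> (forall i, a i 0 != 0 -> `|t 0 i| <= M) ->
  norm2 (diag_mx t *m a) <= M * norm2 a.
Proof.
move=> M0 H; apply: norm2_le; first by rewrite mulr_ge0 ?norm2_ge0.
rewrite exprMn norm2_sqr mulr_sumr; apply: ler_sum => i _.
rewrite diag_mulE exprMn; have [->|/H ti] := eqVneq (a i 0) 0.
  by rewrite expr0n !mulr0.
rewrite ler_wpM2r ?sqr_ge0 // -[t 0 i ^+ 2]real_normK ?num_real //.
by rewrite ler_pXn2r // nnegrE.
Qed.

Lemma norm2_diag_ge p (t : 'rV[R]_p) (a : 'cV[R]_p) (M : R) :
  0 <= M -> (forall i, a i 0 != 0 -> M <= t 0 i) ->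
  M * norm2 a <= norm2 (diag_mx t *m a).
Proof.
move=> M0 H; rewrite -(@ler_pXn2r _ 2) // ?nnegrE ?mulr_ge0 ?norm2_ge0 //.
rewrite exprMn !norm2_sqr mulr_sumr; apply: ler_sum => i _.
rewrite diag_mulE exprMn; have [->|/H ti] := eqVneq (a i 0) 0.
  by rewrite expr0n !mulr0.
by rewrite ler_wpM2r ?sqr_ge0 // ler_pXn2r // nnegrE // (le_trans M0).
Qed.

(* The bound [||A||_op <= d], phrased through the bilinear form. *)
Definition op_bound p q (A : 'M[R]_(p, q)) (d : R) : Prop :=
  forall u v, (u^T *m (A *m v)) 0 0 <= d * norm2 u * norm2 v.

Lemma op_bound_mul p q (A : 'M[R]_(p, q)) d v :
  0 <= d -> op_bound A d -> norm2 (A *m v) <= d * norm2 v.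
Proof.
move=> d0 /(_ (A *m v) v); rewrite dotvv expr2.
have [->|n0] := eqVneq (norm2 (A *m v)) 0; first by rewrite mulr_ge0 ?norm2_ge0.
by rewrite mulrAC ler_pM2r // lt_neqAle eq_sym n0 norm2_ge0.
Qed.

Lemma op_bound_tr p q (A : 'M[R]_(p, q)) d : op_bound A d -> op_bound A^T d.
Proof.
move=> H u v; have := H v u.
have -> : v^T *m (A *m u) = (u^T *m (A^T *m v))^T.
  by rewrite !trmx_mul !trmxK mulmxA.
by rewrite [_^T 0 0]mxE mulrAC.
Qed.

Lemma op_boundD p q (A B : 'M[R]_(p, q)) d e :
  op_bound A d -> op_bound B e -> op_bound (A + B) (d + e).
Proof.
move=> HA HB u v; rewrite mulmxDl mulmxDr mxE !mulrDl.
exact: lerD (HA u v) (HB u v).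
Qed.

Lemma op_boundZ p q (A : 'M[R]_(p, q)) (a d : R) :
  op_bound A d -> op_bound (a *: A) (`|a| * d).
Proof.
move=> H u v.
have [a0|a0] := leP 0 a.
  by rewrite ger0_norm // -scalemxAl -scalemxAr mxE -!mulrA ler_wpM2l // mulrA.
rewrite ltr0_norm //.
(* [op_bound] bounds the form from above only; the sign of [a] is absorbed by the vector [v]. *)
have -> : a *: A *m v = (- a) *: (A *m (- v)).
  by rewrite -scalemxAl mulmxN scalerN scaleNr opprK.
rewrite -scalemxAr mxE -!mulrA ler_wpM2l ?oppr_ge0 ?(ltW a0) //.
by have := H u (- v); rewrite norm2N mulrA.
Qed.

Lemma op_bound_le p q (A : 'M[R]_(p, q)) (d e : R) :
  op_bound A d -> d <= e -> op_bound A e.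
Proof.
move=> H de u v; apply: le_trans (H u v) _.
by rewrite -!mulrA ler_wpM2r // mulr_ge0 ?norm2_ge0.
Qed.

(** The operator norm is at most the Frobenius norm; Cauchy-Schwarz is applied row by row. *)
Lemma op_bound_entries p q (A : 'M[R]_(p, q)) (a : R) :
  0 <= a -> (forall i j, `|A i j| <= a) ->
  op_bound A (a * Num.sqrt (p * q)%:R).
Proof.
move=> a0 HA u v; apply: le_trans (dot_le_norm2 _ _) _.
rewrite [_ * norm2 u]mulrC -mulrA ler_wpM2l ?norm2_ge0 //.
apply: norm2_le; first by rewrite !mulr_ge0 ?norm2_ge0 ?sqrtr_ge0.
rewrite !exprMn sqr_sqrtr ?ler0n // norm2_sqr.
apply: (@le_trans _ _ (\sum_(i < p) (a ^+ 2 * q%:R) * \sum_j v j 0 ^+ 2)).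
  apply: ler_sum => i _; rewrite mxE.
  apply: le_trans (sum_mul_sqr_le _ _) _.
  rewrite ler_wpM2r ?sumr_ge0 // => [j _|]; first exact: sqr_ge0.
  apply: (@le_trans _ _ (\sum_(j < q) a ^+ 2)).
    apply: ler_sum => j _; rewrite -[A i j ^+ 2]real_normK ?num_real //.
    by rewrite ler_pXn2r // nnegrE.
  by rewrite sumr_const card_ord mulr_natr.
by rewrite sumr_const card_ord -mulr_natr natrM le_eqVlt; apply/orP; left; apply/eqP; ring.
Qed.

End EuclideanNorm.

(** * Singular values under perturbation, and the deterministic error bound *)

Section Svd.
Variable R : realType.

(* dimension count: [k] coordinates against fewer than [k] equations *)
Lemma exists_supported_kernel (q m k : nat) (M : 'M[R]_(q, m)) :
  (k <= q)%N -> (\rank M < k)%N ->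
  exists a : 'cV[R]_q, [/\ a != 0, (forall i : 'I_q, (k <= i)%N -> a i 0 = 0) &
    a^T *m M = 0].
Proof.
move=> kq rk.
pose B : 'M[R]_(k, q) := pid_mx k.
have rB : \rank B = k by rewrite rank_pid_mx.
have nf : ~~ row_free (B *m M).
  by rewrite /row_free neq_ltn (leq_ltn_trans (mxrankM_maxr _ _) rk).
have /rowV0Pn[b /sub_kermxP bBM bn0] : kermx (B *m M) != 0.
  by rewrite kermx_eq0.
have BB : B *m pid_mx k = 1%:M :> 'M[R]_k.
  by rewrite mul_pid_mx minnn (minn_idPr kq) pid_mx_1.
exists (b *m B)^T; split.
- rewrite trmx_eq0; apply: contra bn0 => /eqP bB0.
  by rewrite -[b]mulmx1 -BB mulmxA bB0 mul0mx.
- move=> i ki; rewrite mxE mxE big1 // => j _; rewrite mxE.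
  have -> : (j == i :> nat) = false by apply/negbTE; rewrite neq_ltn (leq_trans (ltn_ord j) ki).
  by rewrite mulr0.
- by rewrite trmxK -mulmxA.
Qed.

Variables (n p : nat).
Local Notation q := (minn n p).

Lemma svd_mulE (A : 'M[R]_(n, p)) s U V (v : 'cV[R]_p) : is_svd A s U V ->
  norm2 (A *m v) = norm2 (diag_mx (\row_i s i) *m (V^T *m v)).
Proof. by case=> UU _ _ _ ->; rewrite -!mulmxA norm2_ortho. Qed.

Lemma svd_mulVE (A : 'M[R]_(n, p)) s U V (a : 'cV[R]_q) : is_svd A s U V ->
  norm2 (A *m (V *m a)) = norm2 (diag_mx (\row_i s i) *m a).
Proof.
move=> H; rewrite (svd_mulE _ H); case: H => _ VV _ _ _.
by rewrite [V^T *m _]mulmxA VV mul1mx.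
Qed.

Lemma svd_le_op (A : 'M[R]_(n, p)) s U V k (d : R) : is_svd A s U V ->
  (k < q)%N -> 0 <= d -> op_bound A d -> s k <= d.
Proof.
move=> H kq d0 Hd; pose e : 'cV[R]_q := delta_mx (Ordinal kq) 0.
have ne : norm2 e = 1.
  rewrite /norm2 (bigD1 (Ordinal kq)) //= mxE !eqxx expr1n big1 ?addr0 ?sqrtr1 //.
  by move=> j jk; rewrite mxE (negbTE jk) expr0n.
have := op_bound_mul (V *m e) d0 Hd.
rewrite (svd_mulVE _ H); case: H => _ VV sge0 _ _.
rewrite (norm2_ortho e VV) ne mulr1; apply: le_trans.
rewrite -[leLHS]mulr1 -ne; apply: norm2_diag_ge; first exact: sge0.
by move=> i; rewrite !mxE eqxx andbT; case: (i =P _) => [->|_]; rewrite ?eqxx.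
Qed.

(** Some nonzero combination of the first [k.+1] right singular vectors lies in the kernel of [A],
    while [A] stretches it by at least [s k]. *)
Lemma svd_rank_eq0 (A : 'M[R]_(n, p)) s U V k : is_svd A s U V ->
  (k < q)%N -> (\rank A <= k)%N -> s k = 0.
Proof.
move=> H kq rk; have [UU VV sge0 sdec AE] := H.
have [a [a0 asup aVA]] : exists a : 'cV[R]_q, [/\ a != 0,
    (forall i : 'I_q, (k.+1 <= i)%N -> a i 0 = 0) & a^T *m (V^T *m A^T) = 0].
  apply: exists_supported_kernel => //.
  by rewrite ltnS (leq_trans (mxrankM_maxr _ _)) // mxrank_tr.
have Aa : A *m (V *m a) = 0.
  by apply: trmx_inj; rewrite !trmx_mul -mulmxA aVA trmx0.
have := svd_mulVE a H; rewrite Aa norm2_0 => H0.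
have : s k * norm2 a <= 0.
  rewrite [leRHS]H0; apply: norm2_diag_ge; first exact: sge0.
  move=> i ai; rewrite mxE; apply: sdec => //.
  by rewrite leqNgt; apply: contra ai => ki; rewrite asup.
rewrite pmulr_lle0; last by rewrite lt_neqAle eq_sym norm2_eq0 a0 norm2_ge0.
by move=> sk; apply/eqP; rewrite eq_le sk sge0.
Qed.

(** Weyl's inequality for the singular value number [k.+1]: [X] kills some nonzero combination of
    the first [k.+1] right singular vectors of [Z]. On it [Z] acts as [Z - X], yet stretches by at
    least [s k]. *)
Lemma svd_perturb_tail (X Z : 'M[R]_(n, p)) s U V k (d : R) : is_svd Z s U V ->
  op_bound (Z - X) d -> 0 <= d -> (k < q)%N -> (\rank X <= k)%N -> s k <= d.
Proof.
move=> H Hd d0 kq rk; have [UU VV sge0 sdec ZE] := H.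
have [a [a0 asup aVA]] : exists a : 'cV[R]_q, [/\ a != 0,
    (forall i : 'I_q, (k.+1 <= i)%N -> a i 0 = 0) & a^T *m (V^T *m X^T) = 0].
  apply: exists_supported_kernel => //.
  by rewrite ltnS (leq_trans (mxrankM_maxr _ _)) // mxrank_tr.
have Xa : X *m (V *m a) = 0.
  by apply: trmx_inj; rewrite !trmx_mul -mulmxA aVA trmx0.
have na : 0 < norm2 a by rewrite lt_neqAle eq_sym norm2_eq0 a0 norm2_ge0.
rewrite -(ler_pM2r na).
have := op_bound_mul (V *m a) d0 Hd.
rewrite (norm2_ortho a VV) mulmxBl Xa subr0 (svd_mulVE _ H); apply: le_trans.
apply: norm2_diag_ge; first exact: sge0.
move=> i ai; rewrite mxE; apply: sdec => //.
by rewrite leqNgt; apply: contra ai => ki; rewrite asup.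
Qed.

(** Weyl's inequality in the other direction: the test vector combines the first [k.+1] right
    singular vectors of [X] and is orthogonal to the first [k] of [Z]. [X] stretches it by at least
    [s' k], and [Z] by at most [s k]. *)
Lemma svd_perturb_head (X Z : 'M[R]_(n, p)) s U V s' U' V' k (d : R) :
  is_svd X s' U' V' -> is_svd Z s U V ->
  op_bound (Z - X) d -> 0 <= d -> (k < q)%N -> s' k <= s k + d.
Proof.
move=> H' H Hd d0 kq; have [UU VV sge0 sdec ZE] := H.
have [UU' VV' sge0' sdec' XE] := H'.
(* [pid_mx k] keeps the first [k] columns of [V], which makes [k] equations for [k.+1] unknowns. *)
have [a [a0 asup aVA]] : exists a : 'cV[R]_q, [/\ a != 0,
    (forall i : 'I_q, (k.+1 <= i)%N -> a i 0 = 0) &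
    a^T *m (V'^T *m V *m (pid_mx k : 'M[R]_(q, k))) = 0].
  apply: exists_supported_kernel => //.
  by rewrite ltnS; exact: rank_leq_col.
have na : 0 < norm2 a by rewrite lt_neqAle eq_sym norm2_eq0 a0 norm2_ge0.
have orth (i : 'I_q) : (i < k)%N -> (V^T *m (V' *m a)) i 0 = 0.
  move=> ik; have /matrixP/(_ 0 (Ordinal ik)) := aVA.
  rewrite !mulmxA mxE [RHS]mxE (bigD1 i) //= big1 ?addr0 => [|j ji].
    rewrite [pid_mx _ _ _]mxE /= eqxx ik mulr1 => <-.
    have -> : a^T *m V'^T *m V = (V^T *m V' *m a)^T by rewrite !trmx_mul !trmxK mulmxA.
    by rewrite [RHS]mxE.
  by rewrite [pid_mx _ _ _]mxE /= -val_eqE /= in ji *; rewrite (negbTE ji) mulr0.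
rewrite -(ler_pM2r na).
have H1 : s' k * norm2 a <= norm2 (X *m (V' *m a)).
  rewrite (svd_mulVE _ H'); apply: norm2_diag_ge; first exact: sge0'.
  move=> i ai; rewrite mxE; apply: sdec' => //.
  by rewrite leqNgt; apply: contra ai => ki; rewrite asup.
have H2 : norm2 (Z *m (V' *m a)) <= s k * norm2 a.
  rewrite (svd_mulE _ H).
  apply: (@le_trans _ _ (s k * norm2 (V^T *m (V' *m a)))).
    apply: norm2_diag_le; first exact: sge0.
    move=> i ai; rewrite mxE ger0_norm ?sge0 //; apply: sdec => //.
    by rewrite leqNgt; apply: contra ai => ki; rewrite orth.
  rewrite ler_wpM2l ?sge0 //.
  by apply: le_trans (norm2_ortho_tr _ VV) _; rewrite norm2_ortho.
have H3 := op_bound_mul (V' *m a) d0 Hd.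
rewrite (norm2_ortho a VV') mulmxBl in H3.
have := norm2B_le (Z *m (V' *m a)) (Z *m (V' *m a) - X *m (V' *m a)).
rewrite opprB addrC subrK; lra.
Qed.

(** Any preimage [a0] is replaced by its component along the first [r] left singular vectors. This
    leaves the image unchanged, since the later singular values vanish, and on that span [X^T]
    stretches by at least the [r]-th one. *)
Lemma rowspace_preimage (X : 'M[R]_(n, p)) s U V (beta : 'cV[R]_p) :
  is_svd X s U V -> (beta^T <= X)%MS -> 0 < s (\rank X).-1 ->
  (0 < \rank X)%N ->
  exists alpha : 'cV[R]_n,
    beta = X^T *m alpha /\ s (\rank X).-1 * norm2 alpha <= norm2 beta.
Proof.
move=> H /submxP[a0 ba] sr r0; have [UU VV sge0 sdec XE] := H.
set r := \rank X in sr r0 *.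
have rq : (r <= q)%N by rewrite leq_min rank_leq_row rank_leq_col.
pose a : 'cV[R]_q := \col_(i < q) (if (i < r)%N then (U^T *m a0^T) i 0 else 0).
have Xt (x : 'cV_n) : X^T *m x = V *m (diag_mx (\row_(i < q) s i) *m (U^T *m x)).
  by rewrite XE !trmx_mul tr_diag_mx trmxK !mulmxA.
have bE : beta = V *m (diag_mx (\row_(i < q) s i) *m a).
  rewrite -[LHS]trmxK ba trmx_mul Xt; congr mulmx.
  apply/colP => i; rewrite !diag_mulE !mxE.
  case: ltnP => // ri; rewrite (svd_rank_eq0 H) ?mul0r //.
exists (U *m a); split; first by rewrite Xt [U^T *m _]mulmxA UU mul1mx.
rewrite bE (norm2_ortho _ VV) norm2_ortho //; apply: norm2_diag_ge; first exact: ltW.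
move=> i; rewrite !mxE; case: ifP => [ir _|]; last by rewrite eqxx.
by apply: (sdec i r.-1); [rewrite -ltnS prednK | rewrite prednK].
Qed.

Lemma pcr_betaE k s (U : 'M[R]_(n, q)) (V : 'M[R]_(p, q)) y :
  pcr_beta k s U V y =
  V *m (diag_mx (\row_(i < q) if (i < k)%N then (s i)^-1 else 0) *m (U^T *m y)).
Proof.
rewrite /pcr_beta big_mkcond; apply/colP => j; rewrite summxE [RHS]mxE.
apply: eq_bigr => i _; rewrite diag_mulE [(\row__ _) _ _]mxE.
case: ifP => _; last by rewrite !mxE mul0r mulr0.
rewrite [in LHS]mxE [in LHS]mxE big_ord1 [col _ _ _ _]mxE mulrCA; congr (_ * (_ * _)).
by rewrite !mxE; apply: eq_bigr => l _; rewrite !mxE.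
Qed.

(** The pseudo-inverse has norm at most [2 / sr], which accounts for [2 * d] and for the noise term;
    the part of [beta] lost by the projection costs [3 * d * norm2 alpha], with
    [norm2 alpha <= norm2 beta / sr]. Hence the factor 5. *)
Lemma pcr_error_le (X Z : 'M[R]_(n, p)) sX UX VX s U V (beta : 'cV[R]_p)
    (e : 'cV[R]_n) (d : R) :
  is_svd X sX UX VX -> is_svd Z s U V -> (beta^T <= X)%MS -> (0 < \rank X)%N ->
  0 <= d -> op_bound (Z - X) d -> 0 < sX (\rank X).-1 ->
  2 * d <= sX (\rank X).-1 ->
  norm2 (pcr_beta (\rank X) s U V (X *m beta + e) - beta) <=
    (5 * d * norm2 beta + 2 * norm2 e) / sX (\rank X).-1.
Proof.
move=> HX HZ bX r0 d0 Hd sr0 dsr; have [UU VV sge0 sdec ZE] := HZ.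
have [alpha [bE na]] := rowspace_preimage HX bX sr0 r0.
set r := \rank X in r0 sr0 dsr bE na *; set sr := sX r.-1 in sr0 dsr na *.
have rq : (r <= q)%N by rewrite leq_min rank_leq_row rank_leq_col.
have r1q : (r.-1 < q)%N by rewrite prednK.
(* Indices start at 0, so [r.-1] is the [r]-th singular value; it loses at most [d], which is at
   most half of [sr]. *)
have sr' : sr / 2 <= s r.-1.
  have := svd_perturb_head HX HZ Hd d0 r1q; rewrite -/sr; lra.
have spos i : (i < r)%N -> sr / 2 <= s i.
  by move=> ir; apply: le_trans sr' _; apply: sdec => //; rewrite -ltnS prednK.
set D := Z - X in Hd.
set T := diag_mx (\row_(i < q) if (i < r)%N then (s i)^-1 else 0).
set S := diag_mx (\row_(i < q) s i) in ZE.
pose J : 'M[R]_q := diag_mx (\row_(i < q) if (i < r)%N then 1 else 0).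
have TS : T *m S = J.
  rewrite /T /S mulmx_diag /J; congr diag_mx; apply/rowP => i; rewrite !mxE.
  case: ifP => ir; last by rewrite mul0r.
  rewrite mulVf // gt_eqF // (lt_le_trans _ (spos _ ir)) //; lra.
have Xb : X *m beta + e = Z *m beta + (e - D *m beta).
  by rewrite /D mulmxBl opprB addrCA (addrC (Z *m beta)) subrK addrC.
have VTle y : norm2 (V *m (T *m (U^T *m y))) <= 2 / sr * norm2 y.
  rewrite norm2_ortho //.
  apply: (@le_trans _ _ (2 / sr * norm2 (U^T *m y))).
    apply: norm2_diag_le; first by rewrite divr_ge0 // ltW.
    move=> i _; rewrite mxE; case: ifP => ir; last by rewrite normr0 divr_ge0 // ltW.
    have s0 : 0 < s i by apply: lt_le_trans (spos _ ir); lra.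
    rewrite ger0_norm ?invr_ge0 ?(ltW s0) // -[leRHS]invrK lef_pV2 ?posrE ?invr_gt0 ?divr_gt0 //.
    by rewrite invf_div spos.
  by rewrite ler_wpM2l ?norm2_ortho_tr // divr_ge0 // ltW.
have VJle y : norm2 (V *m (J *m (V^T *m y))) <= norm2 y.
  rewrite norm2_ortho //; apply: (@le_trans _ _ (1 * norm2 (V^T *m y))).
    apply: norm2_diag_le => // i _; rewrite mxE.
    by case: ifP; rewrite ?normr1 ?normr0.
  by rewrite mul1r norm2_ortho_tr.
(* Writing the response as [Z *m beta + (e - D *m beta)], the estimator projects [beta] exactly onto
   the top [r] right singular vectors of [Z], up to the pseudo-inverse of the remainder. *)
have -> : pcr_beta r s U V (X *m beta + e) - beta =
    V *m (T *m (U^T *m (e - D *m beta))) - (beta - V *m (J *m (V^T *m beta))).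
  have ZJ : V *m (T *m (U^T *m (Z *m beta))) = V *m (J *m (V^T *m beta)).
    by rewrite {1}ZE -TS !mulmxA -(mulmxA (V *m T) U^T U) UU mulmx1.
  rewrite pcr_betaE -/T Xb; set y := e - D *m beta.
  by rewrite mulmxDr (mulmxDr T) (mulmxDr V) ZJ opprB addrCA addrA.
have Zt : Z^T = V *m S *m U^T.
  by rewrite ZE !trmx_mul tr_diag_mx trmxK !mulmxA.
have proj : norm2 (beta - V *m (J *m (V^T *m beta))) <= 3 * d * norm2 alpha.
  have bE' : beta = Z^T *m alpha - D^T *m alpha.
    by rewrite bE /D [(Z - X)^T]linearB /= mulmxBl subKr.
  (* The complementary projection leaves only the tail singular values of [Z^T *m alpha], each at
     most [d]; [D^T *m alpha] and its projection contribute [d] each. *)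
  have -> : beta - V *m (J *m (V^T *m beta)) =
    V *m (diag_mx (\row_(i < q) if (i < r)%N then 0 else s i) *m (U^T *m alpha)) -
      (D^T *m alpha - V *m (J *m (V^T *m (D^T *m alpha)))).
    have -> : V *m (diag_mx (\row_(i < q) if (i < r)%N then 0 else s i) *m
        (U^T *m alpha)) =
        Z^T *m alpha - V *m (J *m (V^T *m (Z^T *m alpha))).
      rewrite Zt -2!(mulmxA V) -(mulmxA S) [V^T *m (V *m _)]mulmxA VV mul1mx -mulmxBr.
      rewrite [J *m _]mulmxA -mulmxBl mulmx_diag -linearB /=; congr (_ *m (diag_mx _ *m _)).
      by apply/rowP => i; rewrite !mxE; case: ifP => _; rewrite ?mul1r ?mul0r ?subrr ?subr0.
    by rewrite {1 2}bE' !mulmxBr !opprD !opprK addrACA.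
  have hd : norm2 (V *m (diag_mx (\row_(i < q) if (i < r)%N then 0 else s i) *m
        (U^T *m alpha))) <= d * norm2 alpha.
    rewrite norm2_ortho //; apply: (@le_trans _ _ (d * norm2 (U^T *m alpha))).
      apply: norm2_diag_le => // i _; rewrite mxE; case: ltnP => ir.
        by rewrite normr0.
      rewrite ger0_norm ?sge0 //.
      exact: (svd_perturb_tail HZ Hd d0 (ltn_ord i) ir).
    by rewrite ler_wpM2l // norm2_ortho_tr.
  have hD := op_bound_mul alpha d0 (op_bound_tr Hd).
  have hP := VJle (D^T *m alpha).
  apply: le_trans (norm2B_le _ _) _.
  have := norm2B_le (D^T *m alpha) (V *m (J *m (V^T *m (D^T *m alpha)))).
  lra.
apply: le_trans (norm2B_le _ _) _.
have h1 := VTle (e - D *m beta).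
have h2 := norm2B_le e (D *m beta).
have h3 := op_bound_mul beta d0 Hd.
have h4 : norm2 alpha <= norm2 beta / sr by rewrite ler_pdivlMr // mulrC.
have -> : (5 * d * norm2 beta + 2 * norm2 e) / sr =
  2 / sr * (norm2 e + d * norm2 beta) + 3 * d * (norm2 beta / sr) by ring.
apply: lerD.
  apply: le_trans h1 _; rewrite ler_wpM2l //; first by rewrite divr_ge0 // ltW.
  by apply: le_trans h2 _; rewrite lerD2l.
by apply: le_trans proj _; rewrite ler_wpM2l // mulr_ge0.
Qed.

End Svd.

(** * A net of the unit ball *)

Section LatticeNet.
Variable R : realType.
Implicit Types n p : nat.

(* Sign and absolute value of each coordinate, in units of [1 / (4 sqrt n)]. *)
Definition lattice n := {ffun 'I_n -> bool * 'I_(4 * n).+1}.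

(** In units of [1 / (4 sqrt n)] the bound [16 * n] says that the vector has norm at most 1. *)
Definition lattice_net n : {set lattice n} :=
  [set f : lattice n | (\sum_i (f i).2 ^ 2 <= 16 * n)%N].

Definition lattice_vec n (f : lattice n) : 'cV[R]_n :=
  \col_i ((-1) ^+ (f i).1 * (f i).2%:R / (4 * Num.sqrt n%:R)).

Lemma sum_half_pow_le (m : nat) : \sum_(k < m) (2^-1 : R) ^+ k <= 2.
Proof.
suff -> : \sum_(k < m) (2^-1 : R) ^+ k = 2 - 2 * 2^-1 ^+ m.
  by rewrite lerBlDr lerDl mulr_ge0 // exprn_ge0 // invr_ge0.
elim: m => [|m IH]; first by rewrite big_ord0 expr0 mulr1 subrr.
by rewrite big_ord_recr /= IH exprS; field.
Qed.

(* Each lattice point [f] is counted with weight [2^(16 n) * prod_i 2^(-|f i|) >= 1]. *)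
Lemma card_lattice_net n : #|lattice_net n|%:R <= (2 : R) ^+ (18 * n).
Proof.
rewrite -sum1_card natr_sum.
apply: (@le_trans _ _ (\sum_(f : lattice n) 2 ^+ (16 * n) * \prod_i (2^-1 : R) ^+ (f i).2)).
  rewrite [leRHS](bigID [in lattice_net n]) /= -[leLHS]addr0; apply: lerD; last first.
    apply: sumr_ge0 => f _; apply: mulr_ge0; first exact: exprn_ge0.
    by apply: prodr_ge0 => i _; rewrite exprn_ge0 // invr_ge0.
  apply: ler_sum => f; rewrite inE => Hf.
  rewrite prodrXr exprVn ler_pdivlMr ?exprn_gt0 // mul1r ler_eXn2l ?ltr1n //.
  apply: leq_trans Hf; apply: leq_sum => i _.
  by case: (nat_of_ord (f i).2) => // k; rewrite expnS expn1 leq_pmulr.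
rewrite -mulr_sumr -(bigA_distr_bigA (fun _ (a : bool * 'I_(4 * n).+1) => (2^-1 : R) ^+ a.2)) /=.
(* Each coordinate contributes at most [4 = 2 ^+ 2]: two signs times a geometric sum bounded by
   2. *)
rewrite (_ : (18 * n = 16 * n + 2 * n)%N); last by rewrite -mulnDl.
rewrite exprD ler_wpM2l ?exprn_ge0 // prodr_const card_ord exprM.
apply: lerXn2r; rewrite ?nnegrE ?exprn_ge0 //.
  by apply: sumr_ge0 => a _; rewrite exprn_ge0 // invr_ge0.
rewrite -(pair_bigA _ (fun (_ : bool) (k : 'I_(4 * n).+1) => (2^-1 : R) ^+ k)) /= big_bool /=.
have := sum_half_pow_le (4 * n).+1; rewrite expr2; lra.
Qed.

Let scale_gt0 n : (0 < n)%N -> 0 < 4 * Num.sqrt n%:R :> R.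
Proof. by move=> n0; rewrite mulr_gt0 // sqrtr_gt0 ltr0n. Qed.

Let scale_sqr n : (4 * Num.sqrt n%:R) ^+ 2 = (16 * n)%:R :> R.
Proof. by rewrite exprMn sqr_sqrtr ?ler0n // natrM; congr (_ * _); ring. Qed.

Lemma norm2_lattice_vec n (f : lattice n) : (0 < n)%N -> f \in lattice_net n ->
  norm2 (lattice_vec f) <= 1.
Proof.
move=> n0; rewrite inE => Hf; apply: norm2_le => //; rewrite expr1n.
under eq_bigr do rewrite mxE !exprMn -exprM mulnC exprM sqrrN !expr1n mul1r exprVn
  scale_sqr -natrX.
rewrite -mulr_suml -natr_sum ler_pdivrMr ?ltr0n ?muln_gt0 // mul1r ler_nat.
exact: Hf.
Qed.

(** Coordinates are rounded towards zero, which keeps the point in the unit ball; each moves by at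
    most [1 / h], so the squared error is at most [n / (16 n)], that is [(1/4)^2]. *)
Lemma lattice_net_approx n (v : 'cV[R]_n) : (0 < n)%N -> norm2 v <= 1 ->
  exists2 f, f \in lattice_net n & norm2 (v - lattice_vec f) <= 4^-1.
Proof.
move=> n0 v1; set h := 4 * Num.sqrt n%:R : R.
have h0 : 0 < h by exact: scale_gt0.
have sv : \sum_i v i 0 ^+ 2 <= 1.
  by rewrite -norm2_sqr -(expr1n _ 2) ler_pXn2r // nnegrE ?norm2_ge0.
pose k i := Num.truncn (`|v i 0| * h).
have kle i : (k i)%:R <= `|v i 0| * h.
  by rewrite truncn_le // mulr_ge0 // ltW.
have klt i : `|v i 0| * h < (k i).+1%:R by exact: truncnS_gt.
have sk : (\sum_i k i ^ 2 <= 16 * n)%N.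
  rewrite -(ler_nat R) natr_sum -scale_sqr -/h.
  apply: (@le_trans _ _ (\sum_i v i 0 ^+ 2 * h ^+ 2)).
    apply: ler_sum => i _; rewrite natrX -[v i 0 ^+ 2]real_normK ?num_real //.
    by rewrite -exprMn ler_pXn2r // nnegrE // mulr_ge0 // ltW.
  by rewrite -mulr_suml ler_piMl // exprn_ge0 // ltW.
(* The finite range of the coordinates is wide enough: [k i ^ 2 <= 16 * n <= (4 * n) ^ 2]. *)
have kb i : (k i < (4 * n).+1)%N.
  rewrite ltnS -(@leq_exp2r _ _ 2) //.
  apply: (@leq_trans (16 * n)).
    by apply: leq_trans sk; rewrite (bigD1 i) //= leq_addr.
  by rewrite expnMn leq_mul2l /= expnS expn1 leq_pmulr.
exists [ffun i => (v i 0 < 0, Ordinal (kb i))].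
  by rewrite inE; under eq_bigr do rewrite ffunE /=.
apply: norm2_le; first by rewrite invr_ge0.
apply: (@le_trans _ _ (\sum_(i < n) (h ^+ 2)^-1)).
  apply: ler_sum => i _; rewrite !mxE ffunE /= -/h.
  have -> : v i 0 - (-1) ^+ (v i 0 < 0)%R * (k i)%:R / h =
      (-1) ^+ (v i 0 < 0)%R * ((`|v i 0| * h - (k i)%:R) / h).
    rewrite [in X in _ = _ * ((X * _ - _) / _)]normrEsign.
    by case: (v i 0 < 0)%R; rewrite ?expr1 ?expr0; field; rewrite gt_eqF.
  rewrite exprMn -exprM mulnC exprM sqrrN !expr1n mul1r exprMn exprVn.
  rewrite ler_piMl ?invr_ge0 ?exprn_ge0 ?(ltW h0) //.
  have := kle i; have := klt i; rewrite -natr1 => h1 h2.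
  by rewrite expr_le1 ?subr_ge0 //; lra.
rewrite sumr_const card_ord scale_sqr -mulr_natr natrM.
have n0' : n%:R != 0 :> R by rewrite pnatr_eq0 -lt0n.
by rewrite le_eqVlt; apply/orP; left; apply/eqP; field.
Qed.

Lemma op_bound_ball n p (A : 'M[R]_(n, p)) (M : R) :
  (forall u v, norm2 u <= 1 -> norm2 v <= 1 -> (u^T *m (A *m v)) 0 0 <= M) ->
  op_bound A M.
Proof.
move=> H u v.
have [u0|u0] := eqVneq u 0; first by rewrite u0 trmx0 mul0mx mxE norm2_0 mulr0 mul0r.
have [v0|v0] := eqVneq v 0; first by rewrite v0 !mulmx0 mxE norm2_0 mulr0.
have nu : 0 < norm2 u by rewrite lt_neqAle eq_sym norm2_eq0 u0 norm2_ge0.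
have nv : 0 < norm2 v by rewrite lt_neqAle eq_sym norm2_eq0 v0 norm2_ge0.
have := H ((norm2 u)^-1 *: u) ((norm2 v)^-1 *: v).
rewrite !norm2Z !ger0_norm ?invr_ge0 ?norm2_ge0 // !mulVf ?gt_eqF // => /(_ (lexx _) (lexx _)).
rewrite [(_ *: u)^T]linearZ /= -!scalemxAr -!scalemxAl !mxE.
by rewrite !ler_pdivrMl // mulrA [_ * M]mulrC mulrA.
Qed.

(* With [M] the supremum of the form over the unit balls, rounding both
   arguments gives [M <= t + M/4 + M/4]. *)
Lemma op_bound_net n p (A : 'M[R]_(n, p)) (t : R) : (0 < n)%N -> (0 < p)%N ->
  (forall f g, f \in lattice_net n -> g \in lattice_net p ->
    ((lattice_vec f)^T *m (A *m lattice_vec g)) 0 0 <= t) ->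
  op_bound A (2 * t).
Proof.
move=> n0 p0 H.
pose b (u : 'cV[R]_n) (v : 'cV[R]_p) := (u^T *m (A *m v)) 0 0.
pose S := [set x | exists u v, [/\ norm2 u <= 1, norm2 v <= 1 & x = b u v]].
have b0 : S 0.
  by exists 0, 0; rewrite !norm2_0; split=> //; rewrite /b trmx0 mul0mx mxE.
(* A crude entrywise bound, which only serves to make the supremum finite. *)
have [a a0 Ha] : exists2 a : R, 0 <= a & forall i j, `|A i j| <= a.
  exists (\sum_i \sum_j `|A i j|); first by apply: sumr_ge0 => i _; exact: sumr_ge0.
  move=> i j; rewrite (bigD1 i) //= (bigD1 j) //= -addrA lerDl addr_ge0 ?sumr_ge0 // => k _.
  exact: sumr_ge0.
have Sub : has_ubound S.
  exists (a * Num.sqrt (n * p)%:R) => _ [u [v [u1 v1 ->]]].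
  apply: le_trans (op_bound_entries a0 Ha u v) _.
  rewrite -mulrA ler_piMr ?mulr_ge0 ?sqrtr_ge0 // mulr_ile1 ?norm2_ge0 //.
have bM u v : norm2 u <= 1 -> norm2 v <= 1 -> b u v <= sup S.
  by move=> u1 v1; apply: ub_le_sup => //; exists u, v.
have M0 : 0 <= sup S by apply: ub_le_sup.
have step u v : norm2 u <= 1 -> norm2 v <= 1 -> b u v <= t + sup S / 2.
  move=> u1 v1.
  have [f Hf du] := lattice_net_approx n0 u1.
  have [g Hg dv] := lattice_net_approx p0 v1.
  have h1 := H f g Hf Hg.
  (* Rounding errors have norm at most 1/4, so four times each lies in the unit ball again and is
     subject to the supremum. *)
  have h2 := bM (4 *: (u - lattice_vec f)) v.
  have h3 := bM (lattice_vec f) (4 *: (v - lattice_vec g)).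
  have e1 : b (4 *: (u - lattice_vec f)) v = 4 * (b u v - b (lattice_vec f) v).
    by rewrite /b [(_ *: _)^T]linearZ /= -scalemxAl [(_ - _)^T]linearB /= mulmxBl !mxE.
  have e2 : b (lattice_vec f) (4 *: (v - lattice_vec g)) =
      4 * (b (lattice_vec f) v - b (lattice_vec f) (lattice_vec g)).
    by rewrite /b -!scalemxAr !mulmxBr !mxE.
  rewrite e1 norm2Z ger0_norm // in h2; rewrite e2 norm2Z ger0_norm // in h3.
  have {}h2 := h2 _ v1; have {}h3 := h3 (norm2_lattice_vec n0 Hf) _.
  have : 4 * (b u v - b (lattice_vec f) v) <= sup S by apply: h2; lra.
  have : 4 * (b (lattice_vec f) v - b (lattice_vec f) (lattice_vec g)) <= sup S.
    by apply: h3; lra.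
  rewrite -/(b _ _) in h1; lra.
apply: op_bound_ball => u v u1 v1.
have : sup S <= t + sup S / 2.
  by apply: ge_sup; [exists 0|move=> _ [u' [v' [u1' v1' ->]]]; exact: step].
have := bM u v u1 v1; rewrite /b; lra.
Qed.

End LatticeNet.

(** * Independence *)

Section Independence.
Import HBNNSimple.
Context {d : measure_display} {T : measurableType d} {R : realType}.
Variable P : probability T R.

Lemma measurable_fun_EFin (f : T -> R) : measurable_fun setT f ->
  measurable_fun setT (fun x => (f x)%:E).
Proof. by move=> mf; apply/measurable_EFinP. Qed.

Lemma integral_indicT (A : set T) : measurable A ->
  (\int[P]_x (\1_A x)%:E = P A)%E.
Proof. by move=> mA; rewrite integral_indic // setIT. Qed.

(** The simple-function case of the next lemma: [phi] is a finite combination of indicators of its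
    level sets, whose preimages under [f] are covered by the hypothesis. *)
Lemma ge0_integral_comp_nnsfun_le (f g : T -> R) (C : R) (phi : {nnsfun R >-> R}) :
  measurable_fun setT f -> measurable_fun setT g -> (forall x, 0 <= g x) ->
  0 <= C ->
  (forall B, measurable B ->
    (\int[P]_x (\1_(f @^-1` B) x * g x)%:E <= C%:E * P (f @^-1` B))%E) ->
  (\int[P]_x (phi (f x) * g x)%:E <= C%:E * \int[P]_x (phi (f x))%:E)%E.
Proof.
move=> mf mg g0 C0 H.
pose r := enum_fset (fset_set (range phi)).
have phiE y : phi y = \sum_(z <- r) `|z| * \1_(phi @^-1` [set z]) y.
  rewrite {1}fimfunE fsbig_finite //; apply: eq_big_seq => z.
  have -> : (z \in r) = (z \in fset_set (range phi)) by [].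
  by rewrite in_fset_set // in_setE => -[x _ <-]; rewrite ger0_norm.
pose A z := f @^-1` (phi @^-1` [set z]).
have mA z : measurable (A z).
  by rewrite -[X in measurable X]setTI; apply: mf => //; exact: measurable_funPTI.
have iE z x : \1_(phi @^-1` [set z]) (f x) = \1_(A z) x :> R by rewrite !indicE.
have mI z : measurable_fun setT (\1_(A z) : T -> R) by exact: measurable_indic.
have -> : (\int[P]_x (phi (f x) * g x)%:E =
    \sum_(z <- r) `|z|%:E * \int[P]_x (\1_(A z) x * g x)%:E)%E.
  transitivity (\int[P]_x (\sum_(z <- r) `|z|%:E * (\1_(A z) x * g x)%:E))%E.
    apply: eq_integral => x _; rewrite phiE mulr_suml -sumEFin.
    by apply: eq_bigr => z _; rewrite iE -mulrA EFinM.
  rewrite ge0_integral_sum //.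
  - apply: eq_bigr => z _; rewrite ge0_integralZl_EFin //.
      by move=> x _; rewrite lee_fin mulr_ge0.
    by apply: measurable_fun_EFin; exact: measurable_funM.
  - move=> z; apply: (measurable_fun_EFin (f := fun x => `|z| * (\1_(A z) x * g x))).
    by apply: measurable_funM => //; exact: measurable_funM.
  - by move=> z x _; rewrite lee_fin !mulr_ge0.
have -> : (\int[P]_x (phi (f x))%:E = \sum_(z <- r) `|z|%:E * P (A z))%E.
  transitivity (\int[P]_x (\sum_(z <- r) `|z|%:E * (\1_(A z) x)%:E))%E.
    apply: eq_integral => x _; rewrite phiE -sumEFin.
    by apply: eq_bigr => z _; rewrite iE EFinM.
  rewrite ge0_integral_sum //.
  - apply: eq_bigr => z _; rewrite ge0_integralZl_EFin // ?integral_indicT //.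
    exact: measurable_fun_EFin.
  - move=> z; apply: (measurable_fun_EFin (f := fun x => `|z| * \1_(A z) x)).
    exact: measurable_funM.
rewrite ge0_sume_distrr; last by move=> z _; rewrite mule_ge0 ?lee_fin.
by apply: lee_sum => z _; rewrite muleCA lee_wpmul2l ?lee_fin // H.
Qed.

(** A bound tested on the events generated by [f] extends to [f] itself, by monotone convergence. *)
Lemma ge0_integral_mul_le (f g : T -> R) (C : R) :
  measurable_fun setT f -> (forall x, 0 <= f x) ->
  measurable_fun setT g -> (forall x, 0 <= g x) -> 0 <= C ->
  (forall B, measurable B ->
    (\int[P]_x (\1_(f @^-1` B) x * g x)%:E <= C%:E * P (f @^-1` B))%E) ->
  (\int[P]_x (f x * g x)%:E <= C%:E * \int[P]_x (f x)%:E)%E.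
Proof.
move=> mf f0 mg g0 C0 H.
have mD : measurable `[(0:R), +oo[%classic by [].
have mE : measurable_fun `[(0:R), +oo[%classic (@EFin R).
  exact: EFin_measurable.
(* The identity of the half-line is approximated, rather than [f], so that the approximants
   [phi n (f x)] depend on [f x] only. *)
pose phi := nnsfun_approx mD mE.
have cphi x : EFin \o phi ^~ (f x) @ \oo --> (f x)%:E.
  apply: cvg_nnsfun_approx => [y|]; first by rewrite /= in_itv /= andbT lee_fin.
  by rewrite /= in_itv /= andbT.
have ndphi x n m : (n <= m)%N -> phi n (f x) <= phi m (f x).
  by move=> nm; have /lefP := nd_nnsfun_approx mD mE nm; apply.
have mphi n : measurable_fun setT (fun x => phi n (f x)).
  by apply: measurableT_comp.
have phile n x : phi n (f x) <= f x.
  rewrite -lee_fin -(cvg_lim _ (cphi x)) //; apply: lime_ge.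
    by apply/cvg_ex; exists (f x)%:E; exact: cphi.
  by exists n => // m /= nm; rewrite lee_fin ndphi.
have -> : (\int[P]_x (f x * g x)%:E =
    \int[P]_x limn (fun n => (phi n (f x) * g x)%:E))%E.
  apply: eq_integral => x _; apply/esym/cvg_lim => //.
  exact: (cvgeZr (y := (g x)%:E) isT (cphi x)).
rewrite monotone_convergence //; first last.
- by move=> x _ n m nm; rewrite lee_fin ler_wpM2r ?ndphi.
- by move=> n x _; rewrite lee_fin mulr_ge0.
- by move=> n; apply: measurable_fun_EFin; apply: measurable_funM.
apply: lime_le.
  apply: ereal_nondecreasing_is_cvgn => n m nm.
  apply: ge0_le_integral => //.
  - by move=> x _; rewrite lee_fin mulr_ge0.
  - by apply: measurable_fun_EFin; apply: measurable_funM.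
  - by apply: measurable_fun_EFin; apply: measurable_funM.
  - by move=> x _; rewrite lee_fin ler_wpM2r ?ndphi.
apply: nearW => n; apply: le_trans (ge0_integral_comp_nnsfun_le _ mf mg g0 C0 H) _.
rewrite lee_wpmul2l ?lee_fin //; apply: ge0_le_integral => //.
- by move=> x _; rewrite lee_fin.
- exact: measurable_fun_EFin.
- exact: measurable_fun_EFin.
- by move=> x _; rewrite lee_fin.
Qed.

Lemma indic_bigcap (I : finType) (A : I -> set T) x :
  \prod_i \1_(A i) x = \1_(\bigcap_i A i) x :> R.
Proof.
have [xA|xA] := pselect ((\bigcap_i A i) x).
  rewrite big1 ?indicE ?mem_set // => i _; rewrite indicE mem_set //.
  exact: xA.
rewrite [RHS]indicE memNset //; apply/eqP; rewrite prodf_seq_eq0.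
have [i xAi] : exists i, ~ A i x.
  by apply: contrapT => nA; apply: xA => i _; apply: contrapT => nAi; apply: nA; exists i.
by apply/hasP; exists i; rewrite ?mem_index_enum //= indicE memNset.
Qed.

(** Independence is given for events; the factors are exchanged one at a time for indicators until
    the definition applies. The inequality form needs upper bounds on the integrals only. *)
Lemma mutually_independent_prod_le (I : finType) (G : I -> set (set T))
    (f : I -> T -> R) (c : I -> R) :
  mutually_independent P G -> (forall i, G i `<=` measurable) ->
  (forall i x, 0 <= f i x) ->
  (forall i B, measurable B -> G i (f i @^-1` B)) ->
  (forall i, (\int[P]_x (f i x)%:E <= (c i)%:E)%E) ->
  (\int[P]_x (\prod_i f i x)%:E <= (\prod_i c i)%:E)%E.
Proof.
move=> ind Gm f0 fG fc.
(* [s] lists the indices whose factor may still be a general function; all other factors are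
   indicators. *)
suff gen (s : seq I) : forall (f : I -> T -> R) (c : I -> R),
    (forall i x, 0 <= f i x) ->
    (forall i, (i \in s /\ forall B, measurable B -> G i (f i @^-1` B)) \/
       exists2 A, G i A & f i = \1_A) ->
    (forall i, (\int[P]_x (f i x)%:E <= (c i)%:E)%E) ->
    (\int[P]_x (\prod_i f i x)%:E <= (\prod_i c i)%:E)%E.
  apply: (gen (index_enum I)) => // i; left; split; first exact: mem_index_enum.
  exact: fG.
elim: s => [|i s IH] {f c f0 fG fc}f c f0 fG fc.
  (* With all factors indicators, the integral is the probability of an intersection. *)
  have /choice[A HA] : forall i, exists A, G i A /\ f i = \1_A.
    by move=> i; have [[]//|[A GA fA]] := fG i; exists A.
  have mA i : measurable (A i) by apply: (Gm i); exact: (HA i).1.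
  have -> : (\int[P]_x (\prod_i f i x)%:E = P (\bigcap_i A i))%E.
    rewrite -integral_indicT; last first.
      by apply: fin_bigcap_measurable => //; exact: finite_finset.
    by apply: eq_integral => x _; rewrite -indic_bigcap; under eq_bigr do rewrite (HA _).2.
  rewrite -[X in (X <= _)%E]fineK ?fin_num_measure //; last first.
    by apply: fin_bigcap_measurable => //; exact: finite_finset.
  rewrite lee_fin ind; last by move=> i; exact: (HA i).1.
  apply: ler_prod => i _; rewrite fine_ge0 //= -lee_fin fineK ?fin_num_measure //.
  by rewrite -integral_indicT // -(HA i).2.
have mf j : measurable_fun setT (f j).
  have [[_ Hj]|[A GA ->]] := fG j.
    by move=> _ B mB; rewrite setTI; exact/(Gm j)/Hj.
  by apply: measurable_indic; exact: (Gm j).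
have c0 j : 0 <= c j.
  by rewrite -lee_fin (le_trans _ (fc j)) // integral_ge0 // => x _; rewrite lee_fin.
have [[_ Gi]|[A GA fA]] := fG i; last first.
  apply: IH => // j; have [[]|?] := fG j; last by right.
  rewrite inE => /orP[/eqP ->|js] Hj; last by left.
  by right; exists A.
pose g x := \prod_(j | j != i) f j x.
pose C := \prod_(j | j != i) c j.
have C0 : 0 <= C by apply: prodr_ge0.
have mg : measurable_fun setT g.
  rewrite (_ : g = fun x => \prod_(j <- [seq j <- index_enum I | j != i]) f j x).
    exact: measurable_prod.
  by apply/funext => x; rewrite big_filter.
have g0 x : 0 <= g x by apply: prodr_ge0.
have -> : (\int[P]_x (\prod_i f i x)%:E = \int[P]_x (f i x * g x)%:E)%E.
  by apply: eq_integral => x _; rewrite (bigD1 i).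
have -> : \prod_i c i = C * c i by rewrite (bigD1 i) //= mulrC.
apply: (@le_trans _ _ (C%:E * \int[P]_x (f i x)%:E)%E); last first.
  by rewrite EFinM lee_wpmul2l ?lee_fin.
(* This reduces factor [i] to the indicator of a preimage, with constant [P A], so that [i] can
   leave the list. *)
apply: ge0_integral_mul_le => // B mB.
pose A := f i @^-1` B.
have GA : G i A by exact: Gi.
have mA : measurable A by exact: (Gm i).
pose f' j := if j == i then \1_A else f j.
pose c' j := if j == i then fine (P A) else c j.
have -> : (C%:E * P A = (\prod_j c' j)%:E)%E.
  rewrite (bigD1 i) //= /c' eqxx EFinM fineK ?fin_num_measure // muleC.
  by congr (_ * _%:E)%E; apply: eq_bigr => j /negbTE ->.
have -> : (\int[P]_x (\1_A x * g x)%:E = \int[P]_x (\prod_j f' j x)%:E)%E.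
  apply: eq_integral => x _; rewrite [in RHS](bigD1 i) //= /f' eqxx.
  by congr (_ * _)%:E; apply: eq_bigr => j /negbTE ->.
apply: (IH f' c') => [j x|j|j]; rewrite /f' /c'; have [eji|ji] := eqVneq j i.
- by rewrite indicE.
- exact: f0.
- by right; exists A => //; rewrite eji.
- have [[]|?] := fG j; last by right.
  by rewrite inE (negbTE ji) /= => js Hj; left.
- by rewrite fineK ?fin_num_measure // integral_indicT.
- exact: fc.
Qed.

(** For a subfamily, the indices outside the image of [h] receive the whole space, of probability
    1. *)
Lemma mutually_independent_inj (I J : finType) (h : J -> I) (G : I -> set (set T)) :
  injective h -> (forall i, G i setT) -> mutually_independent P G ->
  mutually_independent P (G \o h).
Proof.
move=> hI GT ind A GA.
pose A' i := if [pick j | h j == i] is Some j then A j else setT.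
have A'h j : A' (h j) = A j.
  rewrite /A'; case: pickP => [k /eqP/hI ->//|/(_ j)]; by rewrite eqxx.
have A'N i : i \notin codom h -> A' i = setT.
  rewrite /A'; case: pickP => // j /eqP <-; by rewrite codom_f.
have -> : \bigcap_j A j = \bigcap_i A' i.
  apply/seteqP; split => x Ax k _.
    have [/codomP[j ->]|/A'N -> //] := boolP (k \in codom h).
    by rewrite A'h; exact: Ax.
  by rewrite -A'h; exact: Ax.
rewrite ind; last first.
  move=> i; rewrite /A'; case: pickP => [j /eqP <-|_]; [exact: GA|exact: GT].
rewrite (bigID [in codom h]) /= [X in _ * X]big1 ?mulr1; last first.
  by move=> i /A'N ->; rewrite probability_setT.
rewrite -big_uniq; last exact/injectiveP.
rewrite codomE big_map big_enum /=.
by apply: eq_bigr => j _; rewrite A'h.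
Qed.

End Independence.

(** * Generated sigma-algebras *)

Section GenSigma.
Context {d : measure_display} {T : measurableType d} {R : realType}.
Implicit Types F : set (T -> R).

Lemma gen_sigma_setT F : gen_sigma F setT.
Proof. by rewrite -setC0; apply: sigma_algebraC; exact: sigma_algebra0. Qed.

Lemma gen_sigma_measurable F : (forall f, F f -> measurable_fun setT f) ->
  gen_sigma F `<=` measurable.
Proof.
move=> mF; apply: smallest_sub; first exact: sigma_algebra_measurable.
by move=> _ [f [B [/mF mf [mB ->]]]]; rewrite -[X in measurable X]setTI; exact: mf.
Qed.

Lemma gen_sigma_preimage F f B : F f -> measurable B -> gen_sigma F (f @^-1` B).
Proof. by move=> Ff mB; apply: sub_sigma_algebra; exists f, B. Qed.

Lemma gen_sigma_comp F f (h : R -> R) B : F f -> measurable_fun setT h ->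
  measurable B -> gen_sigma F ((fun x => h (f x)) @^-1` B).
Proof.
move=> Ff mh mB; apply: (gen_sigma_preimage (B := h @^-1` B)) => //.
by rewrite -[X in measurable X]setTI; exact: mh.
Qed.

(** [T] is equipped with the sigma-algebra generated by the [w j], for which the closure properties
    of measurable functions give the claim. *)
Lemma gen_sigma_lincomb (I : finType) (w : I -> T -> R) (u : I -> R) (h : R -> R) B :
  measurable_fun setT h -> measurable B ->
  gen_sigma [set f | exists j, f = w j]
    ((fun x => h (\sum_j u j * w j x)) @^-1` B).
Proof.
move=> mh mB.
pose G := [set A | exists f B, [set f | exists j, f = w j] f /\
  measurable (B : set R) /\ A = f @^-1` B].
have mw j : measurable_fun (setT : set (g_sigma_algebraType G)) (w j).
  move=> _ C mC; rewrite setTI; apply: gen_sigma_preimage => //; by exists j.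
have : measurable_fun (setT : set (g_sigma_algebraType G))
    (fun x => h (\sum_j u j * w j x)).
  apply: (measurableT_comp mh).
  by apply: measurable_sum => j; apply: measurable_funM.
by move=> /(_ measurableT B mB); rewrite setTI.
Qed.

End GenSigma.

(** * Exponential moments *)

(** The linear term has mean zero for a centred variable, which leaves a sub-gaussian bound. Near 0
    the reason is [expR x <= 1 / (1 - x)]; beyond 1/2, [x <= 2 * x ^+ 2]; below -1/2, the right side
    is at least 1. *)
Lemma expR_le_id_add_expR_sqr (R : realType) (x : R) :
  expR x <= x + expR (2 * x ^+ 2).
Proof.
have h := expR_ge1Dx (2 * x ^+ 2).
have [x2|x2] := leP x (2^-1).
  have [x3|x3] := leP (- 2^-1) x.
    have h1 : 0 < 1 - x by lra.
    have h2 : expR x <= (1 - x)^-1.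
      rewrite -[expR x]invrK -expRN lef_pV2 ?posrE ?expR_gt0 //.
      by have := expR_ge1Dx (- x).
    apply: le_trans h2 _; rewrite -[(1 - x)^-1]mul1r ler_pdivrMr //.
    apply: (@le_trans _ _ ((x + (1 + 2 * x ^+ 2)) * (1 - x))).
      have -> : (x + (1 + 2 * x ^+ 2)) * (1 - x) = 1 + x ^+ 2 * (1 - 2 * x) by ring.
      by rewrite lerDl mulr_ge0 ?sqr_ge0 //; lra.
    by rewrite ler_wpM2r ?(ltW h1) // lerD2l.
  have : expR x <= 1 by rewrite -expR0 ler_expR; lra.
  have : 0 <= x * (2 * x + 1) by rewrite mulr_le0 //; lra.
  nra.
have : expR x <= expR (2 * x ^+ 2).
  rewrite ler_expR -subr_ge0.
  have -> : 2 * x ^+ 2 - x = x * (2 * x - 1) by ring.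
  by rewrite mulr_ge0 //; lra.
lra.
Qed.

Section Tails.
Context {d : measure_display} {T : measurableType d} {R : realType}.
Variable P : probability T R.

Lemma measurable_expR_sqr (c : R) :
  measurable_fun setT (fun y : R => expR (y ^+ 2 / c)).
Proof.
apply: (measurableT_comp (@measurable_expR R)); exact: measurable_funM.
Qed.

(* The factor 2 avoids a discussion of whether the infimum is attained. *)
Lemma psi2_expR_le (X : T -> R) (K : R) : 0 < K -> measurable_fun setT X ->
  (psi2 P X <= K%:E)%E ->
  (\int[P]_x (expR (X x ^+ 2 / (2 * K) ^+ 2))%:E <= 2%:E)%E.
Proof.
move=> K0 mX HX.
have : (psi2 P X < (2 * K)%:E)%E by apply: le_lt_trans HX _; rewrite lte_fin; lra.
move=> /ereal_inf_lt[_ [t [t0 Ht] <-]]; rewrite lte_fin => tK.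
apply: le_trans Ht; apply: ge0_le_integral => //.
- by apply: measurable_fun_EFin; apply: (measurableT_comp (measurable_expR_sqr _)).
- by apply: measurable_fun_EFin; apply: (measurableT_comp (measurable_expR_sqr _)).
- move=> x _; rewrite lee_fin ler_expR ler_wpM2l ?sqr_ge0 //.
  rewrite lef_pV2 ?posrE ?exprn_gt0 //; last lra.
  by rewrite ler_pXn2r // ?nnegrE; lra.
Qed.

(** The psi_2 hypothesis concerns unit vectors, whereas masking a vector may shorten it or make it
    zero; normalising a nonzero [v] can only increase the exponent. *)
Lemma psi2_lincomb_expR_le p (w : 'I_p -> T -> R) (K : R) (v : 'cV[R]_p) : 0 < K ->
  (forall j, measurable_fun setT (w j)) ->
  (forall u : 'cV[R]_p, norm2 u = 1 ->
     (psi2 P (fun x => (\sum_(j < p) u j 0 * w j x)%R) <= K%:E)%E) ->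
  norm2 v <= 1 ->
  (\int[P]_x (expR ((\sum_j v j 0 * w j x) ^+ 2 / (2 * K) ^+ 2))%:E <= 2%:E)%E.
Proof.
move=> K0 mw Hw v1.
have [->|v0] := eqVneq v 0.
  under eq_integral => x _.
    rewrite big1; last by move=> j _; rewrite mxE mul0r.
    rewrite expr0n mul0r expR0; over.
  apply: (@le_trans _ _ (1%:E * P setT)%E); first by rewrite -integral_cst.
  by rewrite probability_setT mule1 lee_fin ler1n.
have nv : 0 < norm2 v by rewrite lt_neqAle eq_sym norm2_eq0 v0 norm2_ge0.
pose u := (norm2 v)^-1 *: v.
have nu : norm2 u = 1.
  by rewrite norm2Z ger0_norm ?invr_ge0 ?norm2_ge0 // mulVf // gt_eqF.
have msum (a : 'cV[R]_p) : measurable_fun setT (fun x => \sum_j a j 0 * w j x).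
  by apply: measurable_sum => j; apply: measurable_funM.
apply: le_trans (psi2_expR_le K0 (msum u) (Hw u nu)).
apply: ge0_le_integral => //.
- by apply: measurable_fun_EFin; apply: (measurableT_comp (measurable_expR_sqr _)).
- by apply: measurable_fun_EFin; apply: (measurableT_comp (measurable_expR_sqr _)).
- move=> x _; rewrite lee_fin ler_expR ler_wpM2r ?invr_ge0 ?sqr_ge0 //.
  have -> : \sum_j v j 0 * w j x = norm2 v * \sum_j u j 0 * w j x.
    rewrite mulr_sumr; apply: eq_bigr => j _.
    by rewrite mxE !mulrA divff ?mul1r // gt_eqF.
  rewrite exprMn ler_piMl ?sqr_ge0 // expr_le1 // norm2_ge0 //.
Qed.

Lemma independent_sum_sqr_expR_le (I : finType) (X : I -> T -> R) (c : R) :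
  mutually_independent P (fun i => gen_sigma [set X i]) ->
  (forall i, measurable_fun setT (X i)) ->
  (forall i, (\int[P]_x (expR (X i x ^+ 2 / c))%:E <= 2%:E)%E) ->
  (\int[P]_x (expR ((\sum_i X i x ^+ 2) / c))%:E <= (2 ^+ #|I|)%:E)%E.
Proof.
move=> ind mX HX; rewrite -prodr_const.
under eq_integral do rewrite mulr_suml expR_sum.
apply: (mutually_independent_prod_le ind) => //.
- by move=> i; apply: gen_sigma_measurable => _ ->.
- by move=> i B mB; apply: (gen_sigma_comp (h := fun y => expR (y ^+ 2 / c))) => //;
    exact: measurable_expR_sqr.
Qed.

Lemma bernoulli_integral (X : T -> R) (rho : R) (h : R -> R) :
  measurable_fun setT X -> (forall x, X x = 0 \/ X x = 1) ->
  fine (P (X @^-1` [set 1])) = rho -> 0 <= h 0 -> 0 <= h 1 ->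
  (\int[P]_x (h (X x))%:E = (rho * h 1 + (1 - rho) * h 0)%:E)%E.
Proof.
move=> mX X01 HP h0 h1.
have mA : measurable (X @^-1` [set 1]) by rewrite -[X in measurable X]setTI; exact: mX.
have mAc : measurable (~` (X @^-1` [set 1])) by exact: measurableC.
have PA : P (X @^-1` [set 1]) = rho%:E by rewrite -HP fineK ?fin_num_measure.
transitivity (\int[P]_x ((h 1)%:E * (\1_(X @^-1` [set 1]) x)%:E +
    (h 0)%:E * (\1_(~` (X @^-1` [set 1])) x)%:E))%E.
  apply: eq_integral => x _; rewrite -!EFinM -EFinD !indicE in_setC.
  have [X0|X1] := X01 x.
    rewrite memNset /= ?mulr0 ?mulr1 ?add0r ?X0 //.
    by apply/eqP; rewrite eq_sym oner_eq0.
  by rewrite mem_set /= ?mulr0 ?mulr1 ?addr0 ?X1.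
rewrite ge0_integralD //; first last.
- by apply: measurable_fun_EFin; apply: measurable_funM => //; exact: measurable_indic.
- by move=> x _; rewrite -EFinM lee_fin mulr_ge0.
- by apply: measurable_fun_EFin; apply: measurable_funM => //; exact: measurable_indic.
- by move=> x _; rewrite -EFinM lee_fin mulr_ge0.
rewrite !ge0_integralZl_EFin //; first last.
- by apply: measurable_fun_EFin; exact: measurable_indic.
- by apply: measurable_fun_EFin; exact: measurable_indic.
rewrite !integral_indicT // probability_setC // PA.
by rewrite -EFinB -!EFinM -EFinD; congr (_%:E); ring.
Qed.

(** [expR_le_id_add_expR_sqr] is applied at both values of [X]; the linear terms, weighted by [rho]
    and [1 - rho], cancel. *)
Lemma bernoulli_mgf_le (X : T -> R) (rho a : R) :
  measurable_fun setT X -> (forall x, X x = 0 \/ X x = 1) ->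
  fine (P (X @^-1` [set 1])) = rho -> 0 <= rho <= 1 ->
  (\int[P]_x (expR (a * (X x - rho)))%:E <= (expR (2 * a ^+ 2))%:E)%E.
Proof.
move=> mX X01 HP /andP[r0 r1].
rewrite (bernoulli_integral (h := fun y => expR (a * (y - rho))) mX X01 HP) ?expR_ge0 //.
rewrite lee_fin sub0r.
have h1 := expR_le_id_add_expR_sqr (a * (1 - rho)).
have h0 := expR_le_id_add_expR_sqr (a * - rho).
have m1 : expR (2 * (a * (1 - rho)) ^+ 2) <= expR (2 * a ^+ 2).
  rewrite ler_expR ler_wpM2l // exprMn ler_piMr ?sqr_ge0 // expr_le1 ?subr_ge0 //; lra.
have m0 : expR (2 * (a * - rho) ^+ 2) <= expR (2 * a ^+ 2).
  rewrite ler_expR ler_wpM2l // exprMn sqrrN ler_piMr ?sqr_ge0 // expr_le1 //.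
have e1 : rho * expR (a * (1 - rho)) <= rho * (a * (1 - rho) + expR (2 * a ^+ 2)).
  by rewrite ler_wpM2l //; lra.
have e0 : (1 - rho) * expR (a * - rho) <= (1 - rho) * (a * - rho + expR (2 * a ^+ 2)).
  by rewrite ler_wpM2l //; lra.
nra.
Qed.

Lemma bernoulli_sum_mgf_le (I : finType) (X : I -> T -> R) (rho : R) (a : I -> R) :
  mutually_independent P (fun i => gen_sigma [set X i]) ->
  (forall i, measurable_fun setT (X i)) -> (forall i x, X i x = 0 \/ X i x = 1) ->
  (forall i, fine (P (X i @^-1` [set 1])) = rho) -> 0 <= rho <= 1 ->
  (\int[P]_x (expR (\sum_i a i * (X i x - rho)))%:E <=
    (expR (2 * \sum_i a i ^+ 2))%:E)%E.
Proof.
move=> ind mX X01 HP r01; rewrite mulr_sumr expR_sum.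
under eq_integral do rewrite expR_sum.
apply: (mutually_independent_prod_le ind) => //.
- by move=> i; apply: gen_sigma_measurable => _ ->.
- move=> i B mB; apply: (gen_sigma_comp (h := fun y => expR (a i * (y - rho)))) => //.
  apply: (measurableT_comp (@measurable_expR R)); apply: measurable_funM => //.
  exact: measurable_funB.
- by move=> i; exact: bernoulli_mgf_le.
Qed.

(* Given the mask [S], row [i] is the linear form of [w i] with coefficients
   [v o S_i], again of norm at most 1; sum over the [2^(n p)] masks. *)
Lemma masked_rows_expR_le n p (w : 'I_n -> 'I_p -> T -> R)
    (pi : 'I_n -> 'I_p -> T -> R) (rho K : R) (v : 'cV[R]_p) : 0 < K ->
  (forall i j, measurable_fun setT (w i j)) ->
  (forall i (u : 'cV[R]_p), norm2 u = 1 ->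
     (psi2 P (fun x => (\sum_(j < p) u j 0 * w i j x)%R) <= K%:E)%E) ->
  (forall i j, measurable_fun setT (pi i j)) ->
  (forall i j x, pi i j x = 0 \/ pi i j x = 1) ->
  (forall i j, fine (P (pi i j @^-1` [set 1])) = rho) -> 0 <= rho <= 1 ->
  mutually_independent P
    (fun a : 'I_n + 'I_n * 'I_p =>
       match a with
       | inl i => gen_sigma [set f | exists j, f = w i j]
       | inr ij => gen_sigma [set pi ij.1 ij.2]
       end) ->
  norm2 v <= 1 ->
  (\int[P]_x (expR ((\sum_i (\sum_j v j 0 * (w i j x * pi i j x)) ^+ 2) /
      (2 * K) ^+ 2))%:E <= (2 ^+ n)%:E)%E.
Proof.
move=> K0 mw Hw mpi pi01 HP r01 ind v1; set c := (2 * K) ^+ 2.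
pose mask := {ffun 'I_n * 'I_p -> bool}.
pose row (S : mask) i x := \sum_j (v j 0 * (S (i, j))%:R) * w i j x.
pose f (S : mask) (a : 'I_n + 'I_n * 'I_p) x : R :=
  match a with
  | inl i => expR (row S i x ^+ 2 / c)
  | inr ij => \1_[set (S ij)%:R] (pi ij.1 ij.2 x)
  end.
pose cst (S : mask) (a : 'I_n + 'I_n * 'I_p) : R :=
  match a with
  | inl i => 2
  | inr ij => if S ij then rho else 1 - rho
  end.
have mrow S i : measurable_fun setT (row S i).
  by apply: measurable_sum => j; apply: measurable_funM.
have mindic (b : bool) : measurable_fun setT (\1_[set b%:R] : R -> R).
  exact: measurable_indic.
have f0 S a x : 0 <= f S a x by case: a => [i|ij] /=; rewrite ?expR_ge0 // indicE.
have mf S a : measurable_fun setT (f S a).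
  case: a => [i|ij] /=; first exact: (measurableT_comp (measurable_expR_sqr c)).
  exact: (measurableT_comp (mindic _)).
have bound (S : mask) : (\int[P]_x (\prod_a f S a x)%:E <= (\prod_a cst S a)%:E)%E.
  apply: (mutually_independent_prod_le ind) => //.
  - move=> [i|ij]; apply: gen_sigma_measurable; first by move=> _ [j ->].
    by move=> _ ->.
  - move=> [i|ij] B mB /=.
      exact: (@gen_sigma_lincomb _ T R 'I_p (w i) (fun j => v j 0 * (S (i, j))%:R)
        _ _ (measurable_expR_sqr c) mB).
    exact: (gen_sigma_comp (h := \1_[set (S ij)%:R])).
  - move=> [i|[i j]] /=.
      pose u : 'cV[R]_p := \col_j (v j 0 * (S (i, j))%:R).
      have u1 : norm2 u <= 1.
        apply: le_trans v1; apply: norm2_le; rewrite ?norm2_ge0 // norm2_sqr.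
        apply: ler_sum => j _; rewrite mxE; case: (S _); rewrite ?mulr1 //.
        by rewrite mulr0 expr0n sqr_ge0.
      have := psi2_lincomb_expR_le K0 (mw i) (Hw i) u1.
      by under eq_integral do under eq_bigr do rewrite mxE.
    rewrite (bernoulli_integral (mpi i j) (pi01 i j) (HP i j)) ?indicE //.
    rewrite lee_fin; case: (S (i, j)) => /=.
      rewrite mem_set // memNset ?mulr1 ?mulr0 ?addr0 //=.
      by move/esym/eqP; rewrite oner_eq0.
    rewrite memNset ?mem_set ?mulr1 ?mulr0 ?add0r //=.
    by move/eqP; rewrite oner_eq0.
(* The mask [S0] realised at [x] already contributes the left side, its indicators all being 1; the
   other terms are nonnegative. *)
have pointwise x : expR ((\sum_i (\sum_j v j 0 * (w i j x * pi i j x)) ^+ 2) / c) <=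
    \sum_(S : mask) \prod_a f S a x.
  pose S0 : mask := [ffun ij => pi ij.1 ij.2 x == 1].
  have S0E ij : (S0 ij)%:R = pi ij.1 ij.2 x.
    rewrite ffunE; have [->|->] := pi01 ij.1 ij.2 x; last by rewrite eqxx.
    by rewrite eq_sym oner_eq0.
  rewrite (bigD1 S0) //= -[leLHS]addr0; apply: lerD; last first.
    by apply: sumr_ge0 => S _; exact: prodr_ge0.
  rewrite big_sumType /= [X in _ <= _ * X]big1 ?mulr1; last first.
    by move=> ij _; rewrite indicE mem_set //= S0E.
  rewrite mulr_suml expR_sum ler_prod // => i _; rewrite expR_ge0 /= ler_expR.
  rewrite le_eqVlt; apply/orP; left; apply/eqP; congr (_ ^+ 2 / _).
  by apply: eq_bigr => j _; rewrite S0E /= -mulrA [w _ _ _ * _]mulrC.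
apply: (@le_trans _ _ (\int[P]_x (\sum_(S : mask) (\prod_a f S a x)%:E))%E).
  apply: ge0_le_integral => //.
    - apply: measurable_fun_EFin; apply: (measurableT_comp (@measurable_expR R)).
    apply: measurable_funM => //; apply: measurable_sum => i; apply: measurable_funX.
    by apply: measurable_sum => j; apply: measurable_funM => //; apply: measurable_funM.
  - apply: emeasurable_sum => S; apply: measurable_fun_EFin; exact: measurable_prod.
  - by move=> x _; rewrite sumEFin lee_fin.
rewrite ge0_integral_sum //; last 2 first.
- by move=> S; apply: measurable_fun_EFin; exact: measurable_prod.
- by move=> S x _; rewrite lee_fin prodr_ge0.
apply: (@le_trans _ _ (\sum_(S : mask) (\prod_a cst S a)%:E)%E).
  exact: lee_sum.
rewrite sumEFin lee_fin.
under eq_bigr do rewrite big_sumType /= prodr_const card_ord.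
(* The weights of the masks sum to a power of [rho + (1 - rho) = 1]. *)
rewrite -mulr_sumr -(bigA_distr_bigA (fun _ (b : bool) => if b then rho else 1 - rho)) /=.
rewrite big1 ?mulr1 // => ij _; rewrite big_bool /=; ring.
Qed.

End Tails.

(** * Union bounds and the high-probability event *)

Section Events.
Context {d : measure_display} {T : measurableType d} {R : realType}.
Variable P : probability T R.

(* The event is [Phi < 1] for the single function [Phi = sum_i exp(g i - s)],
   to which Markov's inequality applies. *)
Lemma chernoff_union (I : finType) (A : {set I}) (g : I -> T -> R) (c s : R) :
  (forall i, measurable_fun setT (g i)) ->
  (forall i, i \in A -> (\int[P]_x (expR (g i x))%:E <= c%:E)%E) ->
  exists E : set T, [/\ measurable E,
    1 - #|A|%:R * (c * expR (- s)) <= fine (P E) &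
    forall x, E x -> forall i, i \in A -> g i x <= s].
Proof.
move=> mg Hg.
pose Phi x := \sum_(i <- enum A) expR (- s) * expR (g i x).
have mexp i : measurable_fun setT (fun x => expR (g i x)).
  exact: (measurableT_comp (@measurable_expR R)).
have mPhi : measurable_fun setT Phi.
  by apply: measurable_sum => i; exact: measurable_funM.
pose E := [set x | Phi x < 1].
have mE : measurable E.
  have -> : E = Phi @^-1` `]-oo, 1[%classic.
    by apply/seteqP; split => x; rewrite /E /= in_itv.
  by rewrite -[X in measurable X]setTI; exact: mPhi.
exists E; split=> //.
- have intPhi : (\int[P]_x (Phi x)%:E <= (#|A|%:R * (c * expR (- s)))%:E)%E.
    under eq_integral do rewrite -sumEFin.
    rewrite ge0_integral_sum //; last first.
      by move=> i; apply: measurable_fun_EFin; exact: measurable_funM.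
    apply: (@le_trans _ _ (\sum_(i <- enum A) (c * expR (- s))%:E)%E); last first.
      by rewrite sumEFin big_const_seq count_predT iter_addr_0 -cardE mulr_natl.
    rewrite !big_enum; apply: lee_sum => i iA.
    under eq_integral do rewrite EFinM.
    rewrite ge0_integralZl_EFin ?expR_ge0 //; last first.
      by apply: measurable_fun_EFin; exact: mexp.
    by rewrite mulrC EFinM lee_wpmul2l ?lee_fin ?expR_ge0 // Hg.
  have mEc : measurable (~` E) by exact: measurableC.
  have : (P (~` E) <= \int[P]_x (Phi x)%:E)%E.
    rewrite -integral_indicT //; apply: ge0_le_integral => //.
    - by apply: measurable_fun_EFin; exact: measurable_indic.
    - exact: measurable_fun_EFin.
    - move=> x _; rewrite lee_fin indicE.
      have [xE|xE] := boolP (x \in ~` E).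
        by move: xE; rewrite in_setE /E /= => /negP; rewrite -leNgt.
      by apply: sumr_ge0 => i _; rewrite mulr_ge0 ?expR_ge0.
  move=> /le_trans/(_ intPhi); rewrite probability_setC //.
  rewrite -[P E]fineK ?fin_num_measure // -EFinB lee_fin => h.
  by rewrite lerBlDr addrC -lerBlDr.
(* If [g i x] exceeded [s], its term alone would be at least 1. *)
- move=> x Ex i iA; rewrite -subr_le0 leNgt; apply/negP => gs.
  have : Phi x < 1 by [].
  rewrite /Phi big_enum (bigD1 i) //= -expRD addrC.
  apply/negP; rewrite -leNgt.
  have h1 : 1 <= expR (- s + g i x) by rewrite -expR0 ler_expR addrC ltW.
  apply: le_trans h1 _; rewrite lerDr; apply: sumr_ge0 => j _.
  by rewrite mulr_ge0 ?expR_ge0.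
Qed.

Lemma probability_setI_ge (E F : set T) (a b : R) :
  measurable E -> measurable F -> 1 - a <= fine (P E) -> 1 - b <= fine (P F) ->
  1 - (a + b) <= fine (P (E `&` F)).
Proof.
move=> mE mF HE HF.
have mI : measurable (E `&` F) by exact: measurableI.
have : (P (~` E `|` ~` F) <= P (~` E) + P (~` F))%E.
  by apply: measureU2; exact: measurableC.
rewrite -setCI !probability_setC // -[P E]fineK ?fin_num_measure //.
rewrite -[P F]fineK ?fin_num_measure // -[P (E `&` F)]fineK ?fin_num_measure //.
rewrite -!EFinB -EFinD lee_fin /=; lra.
Qed.

(** Converts exponential tails into the polynomial rate, through [n <= expR n] and [p <= expR p]. *)
Lemma expR_dimension_le (n p : nat) : (0 < n)%N -> (0 < p)%N ->
  expR (- (10 * (n + p)%:R)) <= 1 / (n * p)%:R ^+ 10 :> R.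
Proof.
move=> n0 p0; rewrite expRN div1r lef_pV2 ?posrE ?expR_gt0 ?exprn_gt0 ?ltr0n ?muln_gt0 ?n0 //.
rewrite (expRM_natl 10) lerXn2r ?nnegrE ?ler0n ?expR_ge0 // natrM natrD expRD.
have ex (k : nat) : k%:R <= expR k%:R :> R.
  by apply: le_trans (expR_ge1Dx _); rewrite lerDr.
by rewrite ler_pM ?ler0n.
Qed.

Lemma pow2_le_expR (k : nat) : (2 : R) ^+ k <= expR k%:R.
Proof.
rewrite -[k%:R]mulr1 expRM_natl lerXn2r ?nnegrE ?expR_ge0 //.
by have := expR_ge1Dx (1 : R).
Qed.

(** With [N = n + p], each event comes from [chernoff_union] at threshold [36 * N]: a net costs at
    most [expR (18 * N)] and a moment at most [expR (2 * N)], which leaves less than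
    [expR (- (10 * N))]. The factor 5 counts [E1], [E2], [E3] once and [E4] twice, for its two
    signs. *)
Lemma good_event n p (X : 'M[R]_(n, p)) (eps : 'I_n -> T -> R)
    (w pi : 'I_n -> 'I_p -> T -> R) (K sig rho : R) :
  (0 < n)%N -> (0 < p)%N -> 0 < K -> 0 < sig -> 0 <= rho <= 1 ->
  (forall i j, `|X i j| <= 1) ->
  (forall i, measurable_fun setT (eps i)) ->
  (forall i, (psi2 P (eps i) <= sig%:E)%E) ->
  (forall i j, measurable_fun setT (w i j)) ->
  (forall i (u : 'cV[R]_p), norm2 u = 1 ->
     (psi2 P (fun x => (\sum_(j < p) u j 0 * w i j x)%R) <= K%:E)%E) ->
  (forall i j, measurable_fun setT (pi i j)) ->
  (forall i j x, pi i j x = 0 \/ pi i j x = 1) ->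
  (forall i j, fine (P (pi i j @^-1` [set 1])) = rho) ->
  mutually_independent P (fun i => gen_sigma [set eps i]) ->
  mutually_independent P (fun ij : 'I_n * 'I_p => gen_sigma [set pi ij.1 ij.2]) ->
  mutually_independent P
    (fun a : 'I_n + 'I_n * 'I_p =>
       match a with
       | inl i => gen_sigma [set f | exists j, f = w i j]
       | inr ij => gen_sigma [set pi ij.1 ij.2]
       end) ->
  let q := Num.sqrt (n + p)%:R in
  exists E : set T, [/\ measurable E,
    1 - 5 / (n * p)%:R ^+ 10 <= fine (P E) &
    forall x, E x -> [/\
      op_bound (\matrix_(i, j) ((X i j + w i j x) * pi i j x) - rho *: X)
        (2 * ((12 * K + 36) * q)),
      norm2 (\col_i eps i x) <= 12 * sig * q &
      `|(\sum_(i < n) \sum_(j < p) pi i j x) / (n * p)%:R - rho| *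
         Num.sqrt (n * p)%:R <= 36 * q]].
Proof.
move=> n0 p0 K0 sig0 r01 HX meps Heps mw Hw mpi pi01 Hpi indE indP indW q.
set N : R := (n + p)%:R.
have N0 : 0 < N by rewrite ltr0n addn_gt0 n0.
have qq : q ^+ 2 = N by rewrite sqr_sqrtr // ltW.
have q0 : 0 < q by rewrite sqrtr_gt0.
have np0 : 0 < (n * p)%:R :> R by rewrite ltr0n muln_gt0 n0.
have pw k l : k%:R <= l * N -> (2 : R) ^+ k <= expR (l * N).
  by move=> kl; apply: le_trans (pow2_le_expR k) _; rewrite ler_expR.
have nN : n%:R <= N by rewrite ler_nat leq_addr.
have pN : p%:R <= N by rewrite ler_nat leq_addl.
have small := expR_dimension_le n0 p0.
pose del : R := 1 / (n * p)%:R ^+ 10.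
(* Masked noise: the squared norm of the image has an exponential moment, so only the right argument
   runs over a net. *)
have [E1 [mE1 PE1 HE1]] : exists E : set T, [/\ measurable E, 1 - del <= fine (P E) &
    forall x, E x -> forall g, g \in lattice_net p ->
      (\sum_i (\sum_j lattice_vec R g j 0 * (w i j x * pi i j x)) ^+ 2) /
        (2 * K) ^+ 2 <= 36 * N].
  have [||E [mE PE HE]] := @chernoff_union _ (lattice_net p) (fun g x =>
    (\sum_i (\sum_j lattice_vec R g j 0 * (w i j x * pi i j x)) ^+ 2) / (2 * K) ^+ 2)
    (2 ^+ n) (36 * N).
  - move=> g; apply: measurable_funM => //; apply: measurable_sum => i; apply: measurable_funX.
    by apply: measurable_sum => j; apply: measurable_funM => //; exact: measurable_funM.
  - move=> g Hg; apply: (masked_rows_expR_le K0 mw Hw mpi pi01 Hpi r01 indW).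
    exact: norm2_lattice_vec.
  exists E; split=> //; apply: le_trans PE; rewrite lerB //.
  apply: (@le_trans _ _ (expR (18 * N) * (expR (1 * N) * expR (- (36 * N))))).
    apply: ler_pM; rewrite ?mulr_ge0 ?exprn_ge0 ?expR_ge0 //.
      by apply: le_trans (card_lattice_net _ _) _; apply: pw; rewrite natrM ler_wpM2l.
    by rewrite ler_wpM2r ?expR_ge0 // pw // mul1r.
  rewrite -!expRD; apply: le_trans small; rewrite ler_expR -/N; lra.
(* Centred mask: with the factor [q] the squared coefficients sum to at most [q ^+ 2 = N]; dividing
   [36 * N] by [q] later gives [36 * q]. *)
have [E2 [mE2 PE2 HE2]] : exists E : set T, [/\ measurable E, 1 - del <= fine (P E) &
    forall x, E x -> forall f g, f \in lattice_net n -> g \in lattice_net p ->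
      \sum_(ij : 'I_n * 'I_p) (q * (lattice_vec R f ij.1 0 * X ij.1 ij.2 *
        lattice_vec R g ij.2 0)) * (pi ij.1 ij.2 x - rho) <= 36 * N].
  have [||E [mE PE HE]] := @chernoff_union _ (finset.setX (lattice_net n) (lattice_net p))
    (fun fg x => \sum_(ij : 'I_n * 'I_p) (q * (lattice_vec R fg.1 ij.1 0 * X ij.1 ij.2 *
        lattice_vec R fg.2 ij.2 0)) * (pi ij.1 ij.2 x - rho)) (expR (2 * N)) (36 * N).
  - move=> fg; apply: measurable_sum => ij; apply: measurable_funM => //.
    exact: measurable_funB.
  - move=> [f g]; rewrite finset.in_setX /= => /andP[Hf Hg].
    apply: le_trans (bernoulli_sum_mgf_le (fun ij => q * (lattice_vec R f ij.1 0 *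
      X ij.1 ij.2 * lattice_vec R g ij.2 0)) indP _ _ _ r01) _ => //.
    rewrite lee_fin ler_expR ler_wpM2l //.
    under eq_bigr do rewrite exprMn qq.
    rewrite -mulr_sumr ler_piMr ?(ltW N0) //.
    apply: (@le_trans _ _ (\sum_(ij : 'I_n * 'I_p)
      lattice_vec R f ij.1 0 ^+ 2 * lattice_vec R g ij.2 0 ^+ 2)).
      apply: ler_sum => ij _; rewrite !exprMn mulrAC ler_piMr //.
        by apply: mulr_ge0; exact: sqr_ge0.
      by rewrite -real_normK ?num_real // expr_le1.
    rewrite -(pair_bigA _ (fun i j => lattice_vec R f i 0 ^+ 2 * lattice_vec R g j 0 ^+ 2)) /=.
    under eq_bigr do rewrite -mulr_sumr -norm2_sqr.
    rewrite -mulr_suml -norm2_sqr mulr_ile1 ?sqr_ge0 // expr_le1 ?norm2_ge0 //.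
      exact: norm2_lattice_vec.
    exact: norm2_lattice_vec.
  exists E; split=> //; last first.
    by move=> x Ex f g Hf Hg; apply: (HE x Ex (f, g)); rewrite finset.in_setX Hf.
  apply: le_trans PE; rewrite lerB //.
  apply: (@le_trans _ _ (expR (18 * N) * (expR (2 * N) * expR (- (36 * N))))).
    apply: ler_pM; rewrite ?mulr_ge0 ?exprn_ge0 ?expR_ge0 //.
    rewrite finset.cardsX natrM; apply: (@le_trans _ _ (2 ^+ (18 * n) * 2 ^+ (18 * p))).
      by apply: ler_pM => //; exact: card_lattice_net.
    by rewrite -exprD -mulnDr; apply: pw; rewrite natrM.
  rewrite -!expRD; apply: le_trans small; rewrite ler_expR -/N; lra.
(* The norm of the noise is bounded directly, without a net, hence the one-point index type. *)
have [E3 [mE3 PE3 HE3]] : exists E : set T, [/\ measurable E, 1 - del <= fine (P E) &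
    forall x, E x -> (\sum_i eps i x ^+ 2) / (2 * sig) ^+ 2 <= 36 * N].
  have [||E [mE PE HE]] := @chernoff_union unit finset.setT
    (fun _ x => (\sum_i eps i x ^+ 2) / (2 * sig) ^+ 2) (2 ^+ n) (36 * N).
  - by move=> _; apply: measurable_funM => //; apply: measurable_sum => i; apply: measurable_funX.
  - move=> _ _; rewrite -[n in (2 ^+ n)%:E]card_ord.
    by apply: independent_sum_sqr_expR_le => // i; exact: psi2_expR_le.
  exists E; split=> //; last by move=> x Ex; apply: (HE x Ex tt); rewrite finset.in_setT.
  apply: le_trans PE; rewrite lerB // finset.cardsT card_unit mul1r.
  apply: (@le_trans _ _ (expR (1 * N) * expR (- (36 * N)))).
    by rewrite ler_wpM2r ?expR_ge0 // pw // mul1r.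
  rewrite -!expRD; apply: le_trans small; rewrite ler_expR -/N; lra.
(* The two values of [b] are the signs of an absolute value; the squared coefficients sum to [N]. *)
have [E4 [mE4 PE4 HE4]] : exists E : set T, [/\ measurable E, 1 - 2 * del <= fine (P E) &
    forall x, E x -> forall b : bool,
      \sum_(ij : 'I_n * 'I_p) ((-1) ^+ b * q / Num.sqrt (n * p)%:R) *
        (pi ij.1 ij.2 x - rho) <= 36 * N].
  have [||E [mE PE HE]] := @chernoff_union bool finset.setT
    (fun b x => \sum_(ij : 'I_n * 'I_p) ((-1) ^+ b * q / Num.sqrt (n * p)%:R) *
      (pi ij.1 ij.2 x - rho)) (expR (2 * N)) (36 * N).
  - move=> b; apply: measurable_sum => ij; apply: measurable_funM => //.
    exact: measurable_funB.
  - move=> b _; apply: le_trans (bernoulli_sum_mgf_le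
      (fun _ => (-1) ^+ b * q / Num.sqrt (n * p)%:R) indP _ _ _ r01) _ => //.
    rewrite lee_fin ler_expR ler_wpM2l // sumr_const card_prod !card_ord.
    rewrite !exprMn -exprM mulnC exprM sqrrN !expr1n mul1r qq exprVn sqr_sqrtr ?ler0n //.
    by rewrite -[leLHS]mulr_natr divfK // gt_eqF.
  exists E; split=> //; last by move=> x Ex b; apply: (HE x Ex b); rewrite finset.in_setT.
  apply: le_trans PE; rewrite lerB // finset.cardsT card_bool ler_wpM2l //.
  rewrite -!expRD; apply: le_trans small; rewrite ler_expR -/N; lra.
exists (E1 `&` E2 `&` (E3 `&` E4)); split.
- by apply: measurableI; exact: measurableI.
- have -> : 5 / (n * p)%:R ^+ 10 = (del + del) + (del + 2 * del) by rewrite /del; ring.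
  apply: probability_setI_ge; try exact: measurableI; exact: probability_setI_ge.
move=> x [[/HE1{}HE1 /HE2{}HE2] [/HE3{}HE3 /HE4{}HE4]]; split.
- apply: op_bound_net => // f g Hf Hg.
  set u := lattice_vec R f; set v := lattice_vec R g.
  have u1 : norm2 u <= 1 by exact: norm2_lattice_vec.
  pose W1 : 'M[R]_(n, p) := \matrix_(i, j) (w i j x * pi i j x).
  pose W2 : 'M[R]_(n, p) := \matrix_(i, j) (X i j * (pi i j x - rho)).
  have -> : \matrix_(i, j) ((X i j + w i j x) * pi i j x) - rho *: X = W1 + W2.
    by apply/matrixP => i j; rewrite !mxE; ring.
  rewrite mulmxDl mulmxDr mxE mulrDl; apply: lerD.
    apply: le_trans (dot_le_norm2 _ _) _.
    apply: (@le_trans _ _ (norm2 (W1 *m v))); first by rewrite ler_piMl ?norm2_ge0.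
    apply: norm2_le; first by rewrite !mulr_ge0 // ltW.
    have := HE1 g Hg; rewrite ler_pdivrMr ?exprn_gt0 ?mulr_gt0 //.
    have -> : 36 * N * (2 * K) ^+ 2 = (12 * K * q) ^+ 2 by rewrite -qq; ring.
    apply: le_trans; rewrite le_eqVlt; apply/orP; left; apply/eqP.
    apply: eq_bigr => i _; rewrite mxE; congr (_ ^+ 2).
    by apply: eq_bigr => j _; rewrite mxE mulrC.
  rewrite -(ler_pM2l q0); have -> : q * (36 * q) = 36 * N by rewrite -qq; ring.
  apply: le_trans (HE2 f g Hf Hg).
  rewrite -(pair_bigA _ (fun i j => (q * (u i 0 * X i j * v j 0)) * (pi i j x - rho))) /=.
  rewrite dotE mulr_sumr le_eqVlt; apply/orP; left; apply/eqP; apply: eq_bigr => i _.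
  have -> : (W2 *m v) i 0 = \sum_j W2 i j * v j 0 by rewrite mxE.
  by rewrite !mulr_sumr; apply: eq_bigr => j _; rewrite [W2 i j]mxE; ring.
- apply: norm2_le; first by rewrite !mulr_ge0 // ltW.
  move: HE3; rewrite ler_pdivrMr ?exprn_gt0 ?mulr_gt0 //.
  have -> : 36 * N * (2 * sig) ^+ 2 = (12 * sig * q) ^+ 2 by rewrite -qq; ring.
  by apply: le_trans; rewrite le_eqVlt; apply/orP; left; apply/eqP; apply: eq_bigr => i _;
    rewrite mxE.
- have s0 : 0 < Num.sqrt (n * p)%:R :> R by rewrite sqrtr_gt0.
  have ss : Num.sqrt (n * p)%:R ^+ 2 = (n * p)%:R :> R by rewrite sqr_sqrtr // ltW.
  set s := Num.sqrt _ in s0 ss HE4 *; set S := \sum_(i < n) _.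
  have sumE : \sum_(ij : 'I_n * 'I_p) (pi ij.1 ij.2 x - rho) = S - rho * s ^+ 2.
    rewrite sumrB sumr_const card_prod !card_ord -mulr_natr -ss; congr (_ - _).
    by rewrite -(pair_bigA _ (fun i j => pi i j x)).
  have key (b : bool) : (-1) ^+ b * ((S / s ^+ 2 - rho) * s) <= 36 * q.
    rewrite -(ler_pM2l q0); have -> : q * (36 * q) = 36 * N by rewrite -qq; ring.
    apply: le_trans (HE4 b); rewrite -mulr_sumr sumE.
    rewrite le_eqVlt; apply/orP; left; apply/eqP; field; rewrite gt_eqF //.
  rewrite -ss -[s in _ * s]gtr0_norm // -normrM ler_norml.
  have := key true; have := key false; rewrite expr1 expr0; lra.
Qed.

End Events.

(** * Choice of the constants and conclusion on the good event *)

Theorem mainTheorem1 (R : realType) :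
  (* absolute constants: c in (i) and the constant in O(1/(np)^10) *)
  exists (c C3 : R), 0 < c /\ 0 < C3 /\
  forall (K gam sig : R), 0 < K -> 0 < gam -> 0 < sig ->
  (* constants hidden in (iii) ||beta*||_2 = Omega(1), (iv) ||beta*||_1 = O(sqrt p) *)
  forall (b B : R), 0 < b -> 0 < B ->
  (* C_noise constants: threshold in (ii) and constant in the bound *)
  exists (C1 C2 : R), 0 < C1 /\ 0 < C2 /\
  forall (n m p : nat), (0 < n)%N -> (0 < m)%N -> (0 < p)%N ->
  forall (X : 'M[R]_(n, p)) (X' : 'M[R]_(m, p)) (beta : 'cV[R]_p),
  forall (sX : nat -> R) (UX : 'M[R]_(n, minn n p)) (VX : 'M[R]_(p, minn n p)),
  forall (rho : R) (d : measure_display) (T : measurableType d)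
         (P : probability T R)
         (eps : 'I_n -> T -> R) (w : 'I_(n + m) -> 'I_p -> T -> R)
         (pi : 'I_(n + m) -> 'I_p -> T -> R),
  (* (A1) *)
  (forall i j, `|X i j| <= 1) -> (forall i j, `|X' i j| <= 1) ->
  (* (A2): r = \rank X; singular values of X given by an SVD *)
  is_svd X sX UX VX ->
  (* (A3) *)
  (forall i, measurable_fun setT (eps i)) ->
  (forall i, P.-integrable setT (EFin \o eps i)) ->
  (forall i, expect P (eps i) = 0) ->
  (forall i, (psi2 P (eps i) <= sig%:E)%E) ->
  (* (A4) *)
  (forall i j, measurable_fun setT (w i j)) ->
  (forall i j, P.-integrable setT (EFin \o w i j)) ->
  (forall i j, expect P (w i j) = 0) ->
  (forall i (u : 'cV[R]_p), norm2 u = 1 ->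
     (psi2 P (fun x => (\sum_(j < p) u j 0 * w i j x)%R) <= K%:E)%E) ->
  (forall i (v : 'cV[R]_p),
     norm2 ((\matrix_(j, k) expect P (fun x => w i j x * w i k x)) *m v)
       <= gam ^+ 2 * norm2 v) ->
  0 < rho <= 1 ->
  (forall i j, measurable_fun setT (pi i j)) ->
  (forall i j x, pi i j x = 0 \/ pi i j x = 1) ->
  (forall i j, fine (P (pi i j @^-1` [set 1])) = rho) ->
  (* mutual independence of all eps_i, all vectors w_i, all coordinates of all pi_i *)
  mutually_independent P
    (fun a : 'I_n + 'I_(n + m) + ('I_(n + m) * 'I_p) =>
       match a with
       | inl (inl i) => gen_sigma [set eps i]
       | inl (inr i) => gen_sigma [set f | exists j, f = w i j]
       | inr ij => gen_sigma [set pi ij.1 ij.2]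
       end) ->
  (* beta* in rowspan(X) *)
  (beta^T <= X)%MS ->
  let r := \rank X in
  let snr := rho * sX r.-1 / (Num.sqrt n%:R + Num.sqrt p%:R) in
  (* (i)-(iv) *)
  rho >= c * (ln (n * p)%:R) ^+ 2 / (n * p)%:R ->
  snr >= C1 ->
  norm2 beta >= b ->
  norm1 beta <= B * Num.sqrt p%:R ->
  (* conclusion: an event of probability >= 1 - C3/(np)^10 on which, for every
     SVD of Z~ = Z / rho_hat, the PCR estimate with k = r satisfies the bound *)
  exists E : set T, measurable E /\
    fine (P E) >= 1 - C3 / ((n * p)%:R ^+ 10) /\
    forall x, E x ->
      let y : 'cV[R]_n := X *m beta + \col_i eps i x in
      let Z : 'M[R]_(n, p) :=
        \matrix_(i, j) ((X i j + w (lshift m i) j x) * pi (lshift m i) j x) in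
      let rho_hat : R :=
        (\sum_(i < n) \sum_(j < p) pi (lshift m i) j x) / (n * p)%:R in
      forall (s : nat -> R) (U : 'M[R]_(n, minn n p)) (V : 'M[R]_(p, minn n p)),
        is_svd (rho_hat^-1 *: Z) s U V ->
        norm2 (pcr_beta r s U V y - beta) ^+ 2 <=
          C2 * ln (n * p)%:R *
            (r%:R * norm2 beta ^+ 2 / snr ^+ 2 + norm1 beta ^+ 2 / snr ^+ 4).

Proof.
exists 1, 5; split=> //; split=> // K gam sig K0 _ sig0 b B b0 _.
(* [D0 * Q / rho] will bound the perturbation: [2 * (12 * K + 36)] comes from [Z - rho *: X], the
   last [36] from the error of [rho_hat], and the outer 2 from [rho_hat >= rho / 2]. *)
pose D0 : R := 2 * (2 * (12 * K + 36) + 36).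
have D00 : 0 < D0 by rewrite /D0; lra.
(* [5 * D0] comes from [pcr_error_le]; the noise costs [24 * sig], which [b <= norm2 beta] turns
   into a multiple of [norm2 beta]. *)
pose c0 : R := 5 * D0 + 24 * sig / b.
have c00 : 0 < c0.
  by apply: addr_gt0; [exact: mulr_gt0 | apply: divr_gt0 => //; exact: mulr_gt0].
have ln2 : 0 < ln (2 : R) by rewrite ln_gt0 // ltr1n.
(* [2 * D0] puts the perturbation below half of the [r]-th singular value of [X], [72] forces
   [rho_hat >= rho / 2], and [ln 2] bounds [ln (n * p)] from below. *)
exists (2 * D0 + 72), (c0 ^+ 2 / ln 2); split; first lra.
split; first by rewrite divr_gt0 ?exprn_gt0.
move=> n m p n0 _ p0 X X' beta sX UX VX rho d T P eps w pi HX _ svdX meps _ _ Heps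
  mw _ _ Hw _ /andP[rho0 rho1] mpi pi01 Hpi ind bX r snr _ Hsnr Hb _.
(* These injections restrict the joint independence to the response noise and to the first [n] rows
   of covariate noise and masks. *)
pose h0 (i : 'I_n) : 'I_n + 'I_(n + m) + ('I_(n + m) * 'I_p) := inl (inl i).
pose h1 (ij : 'I_n * 'I_p) : 'I_n + 'I_(n + m) + ('I_(n + m) * 'I_p) :=
  inr (lshift m ij.1, ij.2).
pose h2 (a : 'I_n + 'I_n * 'I_p) : 'I_n + 'I_(n + m) + ('I_(n + m) * 'I_p) :=
  match a with inl i => inl (inr (lshift m i)) | inr ij => h1 ij end.
have h1I : injective h1 by move=> [i j] [k l] [/= ik ->]; congr (_, _); exact: val_inj.
have h2I : injective h2.
  move=> [i|ij] [k|kl] //=; last by move=> /h1I ->.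
  by move=> [ik]; congr inl; exact: val_inj.
have GT : forall a : 'I_n + 'I_(n + m) + ('I_(n + m) * 'I_p),
    match a with
    | inl (inl i) => gen_sigma [set eps i]
    | inl (inr i) => gen_sigma [set f | exists j, f = w i j]
    | inr ij => gen_sigma [set pi ij.1 ij.2]
    end setT.
  by move=> [[i|i]|ij]; exact: gen_sigma_setT.
have indE : mutually_independent P (fun i => gen_sigma [set eps i]).
  have h0I : injective h0 by move=> i j [].
  exact: (mutually_independent_inj h0I GT ind).
have indP : mutually_independent P
    (fun ij : 'I_n * 'I_p => gen_sigma [set pi (lshift m ij.1) ij.2]).
  exact: (mutually_independent_inj h1I GT ind).
have indW : mutually_independent P
    (fun a : 'I_n + 'I_n * 'I_p =>
       match a with
       | inl i => gen_sigma [set f | exists j, f = w (lshift m i) j]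
       | inr ij => gen_sigma [set pi (lshift m ij.1) ij.2]
       end).
  have -> : (fun a : 'I_n + 'I_n * 'I_p =>
       match a with
       | inl i => gen_sigma [set f | exists j, f = w (lshift m i) j]
       | inr ij => gen_sigma [set pi (lshift m ij.1) ij.2]
       end) = (fun a => match a with
       | inl (inl i) => gen_sigma [set eps i]
       | inl (inr i) => gen_sigma [set f | exists j, f = w i j]
       | inr ij => gen_sigma [set pi ij.1 ij.2]
       end) \o h2 by apply/funext => -[].
  exact: mutually_independent_inj.
have r01 : 0 <= rho <= 1 by rewrite ltW.
have [E [mE PE HE]] := good_event n0 p0 K0 sig0 r01 HX meps Heps
  (fun i j => mw (lshift m i) j) (fun i u => Hw (lshift m i) u)
  (fun i j => mpi (lshift m i) j) (fun i j => pi01 (lshift m i) j)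
  (fun i j => Hpi (lshift m i) j) indE indP indW.
exists E; split=> //; split=> // x /HE[].
set q := Num.sqrt (n + p)%:R; set sq := Num.sqrt (n * p)%:R.
move=> opW neps rhohat y Z rho_hat s U V svdZ.
set Q := Num.sqrt n%:R + Num.sqrt p%:R in snr Hsnr *.
have sn : 0 < Num.sqrt n%:R :> R by rewrite sqrtr_gt0 ltr0n.
have sp : 0 < Num.sqrt p%:R :> R by rewrite sqrtr_gt0 ltr0n.
have Q0 : 0 < Q by rewrite addr_gt0.
have sq0 : 0 < sq by rewrite sqrtr_gt0 ltr0n muln_gt0 n0.
have q0 : 0 < q by rewrite sqrtr_gt0 ltr0n addn_gt0 n0.
have qQ : q <= Q.
  rewrite -(@ler_pXn2r _ 2) ?nnegrE ?ltW // /q /Q sqrrD !sqr_sqrtr ?ler0n //.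
  by rewrite natrD; have := mulr_gt0 sn sp; lra.
have beta0 : 0 < norm2 beta by exact: lt_le_trans Hb.
have snr0 : 0 < snr by apply: lt_le_trans Hsnr; lra.
have sE : sX r.-1 = snr * Q / rho by rewrite /snr; field; rewrite !gt_eqF.
have sr0 : 0 < sX r.-1 by rewrite sE divr_gt0 // mulr_gt0.
(* A zero [X] would force [beta = 0], against [norm2 beta >= b > 0]; so [r.-1] is a genuine
   index. *)
have r0 : (0 < r)%N.
  rewrite lt0n mxrank_eq0; apply: contraTneq beta0 => X0.
  have [a ba] := submxP bX.
  have -> : beta = 0 by apply: trmx_inj; rewrite ba X0 mulmx0 trmx0.
  by rewrite norm2_0 ltxx.
have r1q : (r.-1 < minn n p)%N.
  by rewrite prednK // leq_min rank_leq_row rank_leq_col.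
have opX : op_bound X sq by have := op_bound_entries ler01 HX; rewrite mul1r.
(* Since [snr * Q = rho * sX r.-1], the lower bound on [snr] now makes [rho * sq] a large multiple
   of [Q], so the relative error of [rho_hat] is at most one half. *)
have srsq : sX r.-1 <= sq by exact: (svd_le_op svdX r1q (ltW sq0) opX).
have rhosq : (2 * D0 + 72) * Q <= rho * sq.
  apply: (@le_trans _ _ (snr * Q)); first by rewrite ler_wpM2r // ltW.
  have -> : snr * Q = rho * sX r.-1 by rewrite sE; field; rewrite gt_eqF.
  by rewrite ler_wpM2l // ltW.
have Q36 : 36 * q <= 36 * Q by rewrite ler_wpM2l.
have dev : `|rho_hat - rho| * sq <= 36 * Q by apply: le_trans Q36.
have rho_hat_ge : rho / 2 <= rho_hat.
  have : `|rho_hat - rho| <= rho / 2.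
    rewrite -(ler_pM2r sq0); apply: le_trans dev _.
    have := mulr_gt0 D00 Q0; nra.
  rewrite ler_norml; lra.
have rho_hat0 : 0 < rho_hat by lra.
have rhoV : rho_hat^-1 <= 2 / rho.
  by rewrite -[2 / rho]invf_div lef_pV2 ?posrE //; exact: divr_gt0.
pose dlt := D0 * Q / rho.
have dlt0 : 0 <= dlt by rewrite ltW // divr_gt0 // mulr_gt0.
have opD : op_bound (rho_hat^-1 *: Z - X) dlt.
  (* Rescaling by [rho_hat] instead of [rho] costs [(rho - rho_hat) *: X], of norm at most [36 * Q]
     by [dev]. *)
  have -> : rho_hat^-1 *: Z - X =
      rho_hat^-1 *: ((Z - rho *: X) + (rho - rho_hat) *: X).
    rewrite scalerBl addrA subrK scalerBr scalerA mulVf ?scale1r // gt_eqF //.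
  have opS := op_boundZ rho_hat^-1 (op_boundD opW (op_boundZ (rho - rho_hat) opX)).
  apply: op_bound_le opS _; rewrite ger0_norm ?invr_ge0 ?(ltW rho_hat0) //.
  have -> : dlt = 2 / rho * ((2 * (12 * K + 36) + 36) * Q) by rewrite /dlt /D0; ring.
  apply: ler_pM => //; first by rewrite invr_ge0 ltW.
    have K36 : 0 <= 12 * K + 36 by lra.
    apply: addr_ge0; last by apply: mulr_ge0 => //; exact: ltW.
    by apply: mulr_ge0 => //; apply: mulr_ge0 => //; exact: ltW.
  rewrite [leRHS]mulrDl; apply: lerD; last by rewrite distrC.
  rewrite mulrA; apply: ler_wpM2l qQ; lra.
have dsr : 2 * dlt <= sX r.-1.
  rewrite sE /dlt !mulrA ler_wpM2r ?invr_ge0 ?(ltW rho0) // ler_wpM2r ?(ltW Q0) //.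
  by apply: le_trans Hsnr; rewrite /D0; lra.
have main := pcr_error_le (\col_i eps i x) svdX svdZ bX r0 dlt0 opD sr0 dsr.
have errle : norm2 (pcr_beta r s U V y - beta) <= c0 * norm2 beta / snr.
  apply: le_trans main _; rewrite sE invf_div.
  have -> : (5 * dlt * norm2 beta + 2 * norm2 (\col_i eps i x)) * (rho / (snr * Q)) =
    (5 * D0 * norm2 beta + 2 * norm2 (\col_i eps i x) * rho / Q) / snr.
    by rewrite /dlt; field; rewrite !gt_eqF.
  apply: ler_wpM2r; first by rewrite invr_ge0 ltW.
  have -> : c0 * norm2 beta = 5 * D0 * norm2 beta + 24 * sig * (norm2 beta / b).
    by rewrite /c0; ring.
  apply: lerD => //; apply: (@le_trans _ _ (24 * sig)).
    rewrite ler_pdivrMr //; apply: (@le_trans _ _ (2 * norm2 (\col_i eps i x))).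
      by rewrite ler_piMr // mulr_ge0 ?norm2_ge0.
    have : 12 * sig * q <= 12 * sig * Q by rewrite ler_wpM2l // mulr_ge0 // ltW.
    lra.
  by rewrite ler_peMr ?mulr_ge0 ?(ltW sig0) // ler_pdivlMr // mul1r.
(* At [n * p = 1] the logarithm would vanish; that case contradicts [rhosq], because there
   [rho * sq <= 1 <= Q]. *)
have np2 : (2 <= n * p)%N.
  rewrite ltnNge; apply/negP => np1.
  have sq1 : sq <= 1 by rewrite -sqrtr1 ler_wsqrtr // -[1]/(1%:R) ler_nat -ltnS.
  have sn1 : 1 <= Num.sqrt n%:R :> R by rewrite -{1}sqrtr1 ler_wsqrtr // ler1n.
  have Q1 : 1 <= Q by apply: le_trans sn1 _; rewrite lerDl ltW.
  have h3 : rho * sq <= 1 by rewrite mulr_ile1 // ltW.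
  have h4 := mulr_gt0 D00 Q0.
  have h5 : (2 * D0 + 72) * Q = 2 * (D0 * Q) + 72 * Q by ring.
  by move: (le_trans rhosq h3); rewrite h5; lra.
have lnle : ln (2 : R) <= ln (n * p)%:R.
  by rewrite ler_ln ?posrE ?ltr0n ?muln_gt0 ?n0 // ler_nat.
(* The first term of the bound suffices: [r >= 1], [ln (n * p) >= ln 2], and the [norm1] term is
   nonnegative. *)
apply: (@le_trans _ _ (c0 ^+ 2 * (norm2 beta ^+ 2 / snr ^+ 2))).
  apply: (@le_trans _ _ ((c0 * norm2 beta / snr) ^+ 2)).
    by rewrite lerXn2r ?nnegrE ?norm2_ge0 // !mulr_ge0 ?invr_ge0 ?norm2_ge0 // ltW.
  by rewrite le_eqVlt; apply/orP; left; apply/eqP; field; rewrite gt_eqF.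
have base0 : 0 <= norm2 beta ^+ 2 / snr ^+ 2 by rewrite divr_ge0 ?sqr_ge0.
have -> : c0 ^+ 2 / ln 2 * ln (n * p)%:R *
    (r%:R * norm2 beta ^+ 2 / snr ^+ 2 + norm1 beta ^+ 2 / snr ^+ 4) =
  c0 ^+ 2 * ((ln (n * p)%:R / ln 2) *
    (r%:R * (norm2 beta ^+ 2 / snr ^+ 2) + norm1 beta ^+ 2 / snr ^+ 4)) by ring.
rewrite ler_wpM2l ?sqr_ge0 // -[leLHS]mul1r; apply: ler_pM => //.
  by rewrite ler_pdivlMr // mul1r.
apply: (@le_trans _ _ (r%:R * (norm2 beta ^+ 2 / snr ^+ 2))).
  by rewrite ler_peMl // ler1n.
by rewrite lerDl divr_ge0 ?sqr_ge0 // exprn_ge0 // ltW.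
Qed.
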